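(* Let $\Psi$ be background knowledge (a Boolean function on the set of all DMGs) that is compatible with the acyclification, in the sense that for all DMGs $G$ with $\Psi(G)=1$: (a) there exists an acyclification $G'$ of $G$ with $\Psi(G')=1$; (b) for all nodes $i,j$ of $G$, if $i\in\mathrm{an}_G(j)$ then there exists an acyclification $G'$ of $G$ with $\Psi(G')=1$ and $i\in\mathrm{an}_{G'}(j)$; (c) for all nodes $i,j$ of $G$, if $i\notin\mathrm{an}_G(j)$ then $i\notin\mathrm{an}_{G'}(j)$ for all acyclifications $G'$ of $G$ with $\Psi(G')=1$. Let $\Phi$ be a mapping from independence models to DPAGs. Then: (i) If $\Phi$ is sound for background knowledge $\Psi$ under the additional assumption of acyclicity, then $\Phi$ is sound for background knowledge $\Psi$. (ii) If $\Phi$ is arrowhead (respectively tail) complete for background knowledge $\Psi$ under the additional assumption of acyclicity, then $\Phi$ is arrowhead (respectively tail) complete for background knowledge $\Psi$. (iii) If $\Phi$ is sound and arrowhead complete for background knowledge $\Psi$ under the additional assumption of acyclicity, then $\Phi$ is Markov complete for background knowledge $\Psi$.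
   Context: DMGs. A directed mixed graph (DMG) $G=\langle V,E,F\rangle$ has a finite node set $V$, directed edges $E\subseteq\{(i,j):i\ne j\}$ (written $i\to j$) and bidirected edges $F\subseteq\{\{i,j\}:i\ne j\}$ (written $i\leftrightarrow j$); several edges between two nodes are allowed (at most one of each of $i\to j$, $i\leftarrow j$, $i\leftrightarrow j$). A walk is an alternating sequence of nodes and edges, each edge connecting consecutive nodes; a path is a walk containing each node at most once. $\mathrm{an}_G(j)$ is the set of nodes $i$ with a (possibly trivial) directed path to $j$; $\mathrm{de}_G(i)=\{j:i\in\mathrm{an}_G(j)\}$; $\mathrm{sc}_G(i)=\mathrm{an}_G(i)\cap\mathrm{de}_G(i)$; $\mathrm{an}_G(I)=\bigcup_{i\in I}\mathrm{an}_G(i)$. An ADMG is a DMG without directed cycles. A non-endpoint node on a walk is a collider if both adjacent walk edges have an arrowhead at it; other nodes on it are non-colliders. $\sigma$-separation. A walk is $\sigma$-blocked by $C\subseteq V$ if: its first or last node is in $C$; or it contains a collider not in $\mathrm{an}_G(C)$; or it contains a non-endpoint non-collider $k\in C$ with a directed walk edge $k\to l$ to a neighbouring node $l$ on the walk with $l\notin\mathrm{sc}_G(k)$. $A$ is $\sigma$-separated from $B$ by $C$ if all paths between nodes of $A$ and nodes of $B$ are $\sigma$-blocked by $C$. $\mathrm{IM}_\sigma(G)$ is the set of triples $\langle A,B,C\rangle$ of subsets of $V$ such that $A$ is $\sigma$-separated from $B$ by $C$ in $G$. $G_1,G_2$ are $\sigma$-Markov equivalent if $\mathrm{IM}_\sigma(G_1)=\mathrm{IM}_\sigma(G_2)$.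 An independence model over $V$ is a set of triples of subsets of $V$; a mapping $\Phi$ from independence models to DPAGs assigns to independence models over $V$ (in particular all $\mathrm{IM}_\sigma(G)$ under consideration) a DPAG with node set $V$. For acyclic graphs $\sigma$-separation coincides with $d$-separation. Acyclification. An acyclification of a DMG $G=\langle V,E,F\rangle$ is an ADMG $G'=\langle V,E',F'\rangle$ such that: for any pair $\{i,j\}$ with $i\notin\mathrm{sc}_G(j)$: $i\to j\in E'$ iff there is $j'\in\mathrm{sc}_G(j)$ with $i\to j'\in E$, and $i\leftrightarrow j\in F'$ iff there are $i'\in\mathrm{sc}_G(i)$, $j'\in\mathrm{sc}_G(j)$ with $i'\leftrightarrow j'\in F$; and for any distinct $i,j$ with $i\in\mathrm{sc}_G(j)$: $i\to j\in E'$ or $i\leftarrow j\in E'$ or $i\leftrightarrow j\in F'$. Inducing paths. An inducing path between $i$ and $j$ in a DMG $G$ is a path between them on which every collider is in $\mathrm{an}_G(\{i,j\})$ and each non-endpoint non-collider only has outgoing directed edges (on the path) to neighbouring nodes on the path in the same strongly connected component of $G$. DPAGs. A DPAG is a mixed graph with edges of types $\to,\leftarrow,\leftrightarrow,\circ\!\!\to,\leftarrow\!\!\circ,\circ\!\!-\!\!\circ$, at most one edge between two distinct nodes, no self-cycles, no directed cycle and no almost directed cycle (directed path from $i$ to $j$ together with $j\leftrightarrow i$), and no inducing path between non-adjacent nodes (a path all of whose non-endpoint nodes are colliders on it and ancestors, via directed paths, of an endpoint). $*$ stands for any edge mark. A DPAG $P$ contains a DMG $G$ with the same node set if: (1) $i,j$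 are adjacent in $P$ iff there is an inducing path between them in $G$; (2) $i\,*\!\!\to j$ in $P$ implies $j\notin\mathrm{an}_G(i)$; (3) $i\to j$ in $P$ implies $i\in\mathrm{an}_G(j)$. Soundness and completeness. For background knowledge $\Psi$, $\Phi$ is called: - sound if for all DMGs $G$ with $\Psi(G)=1$, $\Phi(\mathrm{IM}_\sigma(G))$ contains $G$; - arrowhead complete if for all DMGs $G$ with $\Psi(G)=1$ and all distinct $i,j$ adjacent in $\Phi(\mathrm{IM}_\sigma(G))$: if $i\notin\mathrm{an}_{\tilde G}(j)$ for every DMG $\tilde G$ with $\Psi(\tilde G)=1$ that is $\sigma$-Markov equivalent to $G$, then $i\leftarrow\!\!*\,j$ in $\Phi(\mathrm{IM}_\sigma(G))$; - tail complete if for all DMGs $G$ with $\Psi(G)=1$ and all distinct $i,j$ adjacent in $\Phi(\mathrm{IM}_\sigma(G))$: if $i\in\mathrm{an}_{\tilde G}(j)$ for every DMG $\tilde G$ with $\Psi(\tilde G)=1$ that is $\sigma$-Markov equivalent to $G$, then $i\to j$ in $\Phi(\mathrm{IM}_\sigma(G))$; - Markov complete if for all DMGs $G_1,G_2$ (on the same node set) with $\Psi(G_1)=\Psi(G_2)=1$: $G_1$ is $\sigma$-Markov equivalent to $G_2$ iff $\Phi(\mathrm{IM}_\sigma(G_1))=\Phi(\mathrm{IM}_\sigma(G_2))$. A property holds ''for background knowledge $\Psi$ under the additional assumption of acyclicity'' if it holds for the background knowledge $\Psi'$ with $\Psi'(G)=1$ iff $\Psi(G)=1$ and $G$ is acyclic.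 *)

(* Defs.v *)
From HB Require Import structures.
From mathcomp Require Import all_boot.
From mathcomp Require Import boolp.

Set Implicit Arguments.
Unset Strict Implicit.
Unset Printing Implicit Defensive.

(* [e : edge] read from x to y; [To] is x --> y, [From] is x <-- y,
   [CircTo] is x o-> y, [CircFrom] is x <-o y. *)
Inductive edge := To | From | Bidir | CircTo | CircFrom | CircCirc.

Scheme Equality for edge.

Lemma edge_beqP : Equality.axiom edge_beq.
Proof. by case=> -[]; constructor. Qed.

HB.instance Definition _ := hasDecEq.Build edge edge_beqP.

Definition rev_edge (e : edge) : edge :=
  match e with
  | To => From | From => To
  | CircTo => CircFrom | CircFrom => CircTo
  | Bidir => Bidir | CircCirc => CircCirc
  end.

Definition head_src (e : edge) : bool := e \in [:: From; Bidir; CircFrom].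
Definition head_tgt (e : edge) : bool := e \in [:: To; Bidir; CircTo].

(* The walk x e1 y1 e2 y2 ... is given by its first node x and the sequence
   [:: (e1, y1); (e2, y2); ...].  [step x e y] means that the edge e, read
   from x to y, is present in the graph.  The sequence [::] is the trivial walk
   consisting of the single node x. *)
Fixpoint is_walk (V : finType) (step : V -> edge -> V -> bool)
    (x : V) (s : seq (edge * V)) : bool :=
  if s is (e, y) :: s' then step x e y && is_walk step y s' else true.

Definition is_path (V : finType) (step : V -> edge -> V -> bool)
    (x : V) (s : seq (edge * V)) : bool :=
  is_walk step x s && uniq (x :: unzip2 s).

Definition endpoint (V : finType) (x : V) (s : seq (edge * V)) : V :=
  last x (unzip2 s).

(* A non-endpoint occurrence of a node on a walk, with its two adjacent edges
   (both read in the direction of the walk) and neighbouring nodes. *)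
Record visit (V : finType) := Visit
  { prev_node : V; edge_in : edge; node : V; edge_out : edge; next_node : V }.

Fixpoint inner (V : finType) (x : V) (s : seq (edge * V)) : seq (visit V) :=
  if s is (e, y) :: s' then
    if s' is (e', z) :: _ then Visit x e y e' z :: inner y s' else [::]
  else [::].

Definition collider (V : finType) (t : visit V) : bool :=
  head_tgt (edge_in t) && head_src (edge_out t).

Record dmg (V : finType) := Dmg {
  dir : {set V * V};
  bidir : {set {set V}};
  dir_irr : [forall i, (i, i) \notin dir];
  bidir_pair : [forall e in bidir, #|e| == 2] }.

Definition dmg_step (V : finType) (G : dmg V) (x : V) (e : edge) (y : V) : bool :=
  match e with
  | To => (x, y) \in dir G
  | From => (y, x) \in dir G
  | Bidir => [set x; y] \in bidir G
  | _ => false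
  end.

Definition an (V : finType) (G : dmg V) (j : V) : {set V} :=
  [set i | connect [rel x y | (x, y) \in dir G] i j].

Definition de (V : finType) (G : dmg V) (i : V) : {set V} :=
  [set j | i \in an G j].

Definition sc (V : finType) (G : dmg V) (i : V) : {set V} := an G i :&: de G i.

Definition anS (V : finType) (G : dmg V) (I : {set V}) : {set V} :=
  \bigcup_(i in I) an G i.

(* A directed cycle is a directed path from i to j together with j --> i. *)
Definition acyclic (V : finType) (G : dmg V) : bool :=
  [forall i, forall j, (i \in an G j) ==> ((j, i) \notin dir G)].

Definition leaves_sc (V : finType) (G : dmg V) (t : visit V) : bool :=
  ((edge_in t == From) && (prev_node t \notin sc G (node t))) ||
  ((edge_out t == To) && (next_node t \notin sc G (node t))).

Definition sigma_blocked (V : finType) (G : dmg V) (C : {set V})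
    (x : V) (s : seq (edge * V)) : bool :=
  [|| x \in C, endpoint x s \in C,
      has (fun t => collider t && (node t \notin anS G C)) (inner x s) |
      has (fun t => [&& ~~ collider t, node t \in C & leaves_sc G t])
          (inner x s)].

Definition sigma_separated (V : finType) (G : dmg V) (A B C : {set V}) : Prop :=
  forall (x : V) (s : seq (edge * V)),
    is_path (dmg_step G) x s -> x \in A -> endpoint x s \in B ->
    sigma_blocked G C x s.

Definition indep_model (V : finType) := {set {set V} * {set V} * {set V}}.

Definition IM (V : finType) (G : dmg V) : indep_model V :=
  [set t : {set V} * {set V} * {set V} |
    `[< sigma_separated G t.1.1 t.1.2 t.2 >]].

Definition markov_equiv (V : finType) (G1 G2 : dmg V) : Prop := IM G1 = IM G2.

Definition acyclification (V : finType) (G G' : dmg V) : Prop :=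
  [/\ acyclic G',
      forall i j, i \notin sc G j ->
        ((i, j) \in dir G' <-> exists2 j', j' \in sc G j & (i, j') \in dir G),
      forall i j, i \notin sc G j ->
        ([set i; j] \in bidir G' <->
         exists i' j',
           [/\ i' \in sc G i, j' \in sc G j & [set i'; j'] \in bidir G])
    & forall i j, i != j -> i \in sc G j ->
        [\/ (i, j) \in dir G', (j, i) \in dir G' | [set i; j] \in bidir G']].

Definition inducing_path (V : finType) (G : dmg V)
    (x : V) (s : seq (edge * V)) : bool :=
  is_path (dmg_step G) x s &&
  all (fun t => if collider t then node t \in anS G [set x; endpoint x s]
                else ~~ leaves_sc G t) (inner x s).

(* A mixed graph with at most one edge between any two nodes: P (i, j) is the
   edge between i and j read from i to j, or None if there is none. *)
Definition pgraph (V : finType) := {ffun V * V -> option edge}.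

Definition pstep (V : finType) (P : pgraph V) (x : V) (e : edge) (y : V) : bool :=
  P (x, y) == Some e.

Definition pan (V : finType) (P : pgraph V) (j : V) : {set V} :=
  [set i | connect [rel x y | pstep P x To y] i j].

Definition adjacent (V : finType) (P : pgraph V) (i j : V) : bool :=
  P (i, j) != None.

Definition pinducing_path (V : finType) (P : pgraph V)
    (x : V) (s : seq (edge * V)) : bool :=
  is_path (pstep P) x s &&
  all (fun t => collider t && (node t \in pan P x :|: pan P (endpoint x s)))
      (inner x s).

(* The nodes in the last clause are distinct: the trivial path is vacuously an
   inducing path from i to i. *)
Definition is_dpag (V : finType) (P : pgraph V) : Prop :=
  [/\ forall i, P (i, i) = None,
      forall i j, P (j, i) = omap rev_edge (P (i, j)),
      forall i j, i \in pan P j -> ~~ pstep P j To i,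
      forall i j, i \in pan P j -> ~~ pstep P j Bidir i
    & forall i j, i != j -> ~~ adjacent P i j ->
        ~ exists2 s, pinducing_path P i s & endpoint i s = j].

Record dpag (V : finType) := Dpag
  { dpag_graph :> pgraph V; dpagP : is_dpag dpag_graph }.

Lemma dpag_graph_inj (V : finType) : injective (@dpag_graph V).
Proof.
move=> [P hP] [Q hQ] /= eqPQ; case: Q / eqPQ hQ => hQ.
by rewrite (Prop_irrelevance hP hQ).
Qed.

(* [arrow_into P i j] is i *-> j. *)
Definition arrow_into (V : finType) (P : pgraph V) (i j : V) : bool :=
  if P (i, j) is Some e then head_tgt e else false.

Definition contains (V : finType) (P : dpag V) (G : dmg V) : Prop :=
  [/\ forall i j, i != j ->
        (adjacent P i j <-> exists2 s, inducing_path G i s & endpoint i s = j),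
      forall i j, arrow_into P i j -> j \notin an G i
    & forall i j, pstep P i To j -> i \in an G j].

Definition background := forall V : finType, dmg V -> bool.

Definition dpag_map := forall V : finType, indep_model V -> dpag V.

Definition under_acyclicity (Psi : background) : background :=
  fun V G => Psi V G && acyclic G.

Definition acyclification_compatible (Psi : background) : Prop :=
  forall (V : finType) (G : dmg V), Psi V G ->
  [/\ exists2 G', acyclification G G' & Psi V G',
      forall i j, i \in an G j ->
        exists G', [/\ acyclification G G', Psi V G' & i \in an G' j]
    & forall i j, i \notin an G j ->
        forall G', acyclification G G' -> Psi V G' -> i \notin an G' j].

Definition sound (Psi : background) (Phi : dpag_map) : Prop :=
  forall (V : finType) (G : dmg V), Psi V G -> contains (Phi V (IM G)) G.

Definition arrowhead_complete (Psi : background) (Phi : dpag_map) : Prop :=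
  forall (V : finType) (G : dmg V), Psi V G ->
  forall i j, i != j -> adjacent (Phi V (IM G)) i j ->
    (forall G', Psi V G' -> markov_equiv G' G -> i \notin an G' j) ->
    arrow_into (Phi V (IM G)) j i.

Definition tail_complete (Psi : background) (Phi : dpag_map) : Prop :=
  forall (V : finType) (G : dmg V), Psi V G ->
  forall i j, i != j -> adjacent (Phi V (IM G)) i j ->
    (forall G', Psi V G' -> markov_equiv G' G -> i \in an G' j) ->
    pstep (Phi V (IM G)) i To j.

Definition markov_complete (Psi : background) (Phi : dpag_map) : Prop :=
  forall (V : finType) (G1 G2 : dmg V), Psi V G1 -> Psi V G2 ->
    (markov_equiv G1 G2 <-> Phi V (IM G1) = Phi V (IM G2)).

(* Main.v *)
Require Import Defs.
From mathcomp Require Import all_boot.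
From mathcomp Require Import boolp zify.

(** The theorem rests on two facts about independence models.

    First, an acyclification G' of a graph G has the same independence model
    as G ([acyclification_markov_equiv]).  An open walk of G' becomes one of G
    when each of its edges is replaced by that edge with directed walks inside
    strongly connected components attached at its arrowheads; the nodes of such
    detours never block.  Conversely, a stretch of an open walk of G inside one
    component is replaced by at most one edge of G': a stretch entered by an
    arrowhead can be entered at any node of the component instead, and a
    stretch that is left by a tail is joined directly.  Adjacency in a DPAG
    that contains a graph means that no set separates the two nodes
    ([inducing_pathP]), so it also depends on the independence model only.  As
    every ancestral relation of G holds in some acyclification that [Psi]
    admits, and no other ancestral relation does, soundness and completeness
    for acyclic graphs carry over to all graphs.

    Second, two acyclic graphs G1 and G2 are Markov equivalent as soon as they
    have the same adjacencies and each obeys the arrowheads that the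
    independence model of the other forces ([connected_transfer]).  If i and j
    are separated by C but connected given C and x, then x is no ancestor of i,
    of j or of a node of C ([noncause_an]); this reads off from the model, so
    arrowhead completeness puts an arrowhead at x on its edges to those nodes,
    and by soundness both graphs obey it.  Suppose now that i and j are
    connected given C in G2 but not in G1, by a walk that is as short as
    possible and has its colliders in C.  A non-collider x on it is, by
    minimality, connected given C to i and to j in G1 as well, hence i and j
    are connected given C and x in G1.  So x has arrowheads towards all its
    neighbours in C, i or j, and a stretch of non-colliders would start and end
    with arrowheads pointing into it, which forces a collider inside it.
    Therefore all inner nodes of the walk are colliders in C
    ([collider_walk]).  View it as a chain of inducing paths joined at
    colliders in C, and shorten the chain as far as possible.  For each inner
    node c of a shortest chain there is a stretch around c whose ends are not
    adjacent and whose other inner nodes are all ancestors of the ends, while c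
    is not ([separating_span]).  The ends are then separated by their proper
    ancestors and become connected when c is added, so c is detected in G2 as
    a non-ancestor of its neighbours in the chain ([chain_noncause]).  Hence c
    is a collider of the chain in G1 too, and the chain connects i and j given
    C in G1, a contradiction. *)

Set Implicit Arguments.
Unset Strict Implicit.
Unset Printing Implicit Defensive.

(** * Ancestors and strongly connected components *)

Section Ancestors.
Variables (V : finType) (G : dmg V).
Implicit Types (x y z v w k : V) (C : {set V}).

Lemma an_refl x : x \in an G x.
Proof. by rewrite inE connect0. Qed.

Lemma an_trans y x z : x \in an G y -> y \in an G z -> x \in an G z.
Proof. by rewrite !inE; apply: connect_trans. Qed.

Lemma dir_an x y : (x, y) \in dir G -> x \in an G y.
Proof. by move=> xy; rewrite inE; apply: connect1. Qed.

Lemma an_ind_left x (P : V -> Prop) :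
  P x ->
  (forall v w, (v, w) \in dir G -> w \in an G x -> P w -> P v) ->
  forall k, k \in an G x -> P k.
Proof.
move=> Px Pstep k; rewrite inE => /connectP[p].
elim: p k => [|w p IHp] k /=; first by move=> _ <-.
case/andP=> kw wp x_last; apply: (Pstep _ w) => //; last exact: IHp.
by rewrite inE; apply/connectP; exists p.
Qed.

Lemma an_ind_right k (P : V -> Prop) :
  P k ->
  (forall v w, k \in an G v -> (v, w) \in dir G -> P v -> P w) ->
  forall x, x \in de G k -> P x.
Proof.
move=> Pk Pstep x; rewrite !inE => /connectP[p].
elim/last_ind: p x => [|p w IHp] x /=; first by move=> _ ->.
rewrite rcons_path last_rcons => /andP[kp vw] ->.
apply: Pstep vw _; last exact: IHp.
by rewrite inE; apply/connectP; exists p.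
Qed.

Lemma scE x y : (x \in sc G y) = (x \in an G y) && (y \in an G x).
Proof. by rewrite !inE. Qed.

Lemma sc_refl x : x \in sc G x.
Proof. by rewrite scE an_refl. Qed.

Lemma sc_sym x y : (x \in sc G y) = (y \in sc G x).
Proof. by rewrite !scE andbC. Qed.

Lemma sc_trans y x z : x \in sc G y -> y \in sc G z -> x \in sc G z.
Proof.
rewrite !scE => /andP[xy yx] /andP[yz zy].
by rewrite (an_trans xy yz) (an_trans zy yx).
Qed.

Lemma in_anS C x : reflect (exists2 c, c \in C & x \in an G c) (x \in anS G C).
Proof. exact: (iffP bigcupP). Qed.

Lemma anS_closed C x y : x \in an G y -> y \in anS G C -> x \in anS G C.
Proof.
by move=> xy /in_anS[c cC yc]; apply/in_anS; exists c; rewrite ?(an_trans xy).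
Qed.

Lemma sub_anS C : C \subset anS G C.
Proof. by apply/subsetP => c cC; apply/in_anS; exists c; rewrite ?an_refl. Qed.

Lemma anS2 x y v : (v \in anS G [set x; y]) = (v \in an G x :|: an G y).
Proof.
apply/in_anS/setUP => [[c /set2P[] -> vc]|[vc|vc]]; [by left|by right| |].
  by exists x; rewrite ?set21.
by exists y; rewrite ?set22.
Qed.

Lemma anU_closed x y u v :
  u \in an G v -> v \in an G x :|: an G y -> u \in an G x :|: an G y.
Proof. by move=> uv; rewrite !in_setU => /orP[] /(an_trans uv) ->; rewrite ?orbT. Qed.

Lemma an_sub_anU v x y : v \in an G x :|: an G y -> an G v \subset an G x :|: an G y.
Proof. by move=> vA; apply/subsetP => u uv; apply: anU_closed uv vA. Qed.

Lemma acyclic_antisym x y : acyclic G -> x \in an G y -> y \in an G x -> x = y.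
Proof.
move=> acG xy; rewrite inE => /connectP[p].
elim/last_ind: p => [|p w _] /=; first by move=> _ ->.
rewrite rcons_path last_rcons => /andP[yp vw] xw; rewrite -{}xw in vw.
move/forallP/(_ x)/forallP/(_ (last y p)): acG; rewrite [_ \in dir G]vw implybF.
case/negP; apply: an_trans xy _.
by rewrite inE; apply/connectP; exists p.
Qed.

Lemma acyclic_sc x y : acyclic G -> x \in sc G y -> x = y.
Proof. by move=> acG; rewrite scE => /andP[]; apply: acyclic_antisym. Qed.

Lemma dir_neq x y : (x, y) \in dir G -> x != y.
Proof.
by apply: contraTneq => ->; have /forallP := dir_irr G; apply.
Qed.

Lemma step_rev x e y : dmg_step G y (rev_edge e) x = dmg_step G x e y.
Proof. by case: e => //=; rewrite setUC. Qed.

Lemma step_neq x e y : dmg_step G x e y -> x != y.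
Proof.
case: e => //=; [exact: dir_neq | by rewrite eq_sym; apply: dir_neq | ].
apply: contraTneq => ->; apply/negP => h.
by have /forallP/(_ [set y; y])/implyP/(_ h) := bidir_pair G; rewrite setUid cards1.
Qed.

End Ancestors.

(** * Walks with edge marks at both ends *)

(** The tail of a directed edge blocks at a node of the conditioning set only if
    the edge leaves the strongly connected component of that node, so tails are
    split into the two kinds [InnerTail] and [OuterTail]. *)
Inductive mark := Head | InnerTail | OuterTail.

(** Whether a walk may go through [v] with marks [b] and [c] at [v]: [K] holds the
    admissible colliders and [N] the admissible non-colliders with an outgoing
    edge that leaves the component.  Open walks given [C] have [K = anS G C] and
    [N = ~: C]; inducing paths have the ancestors of the ends as [K] and the
    empty set as [N]. *)
Definition passes (V : finType) (K N : {set V}) (v : V) (b c : mark) : bool :=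
  match b, c with
  | Head, Head => v \in K
  | OuterTail, _ | _, OuterTail => v \in N
  | _, _ => true
  end.

Definition src_mark (V : finType) (G : dmg V) (x : V) (e : edge) (y : V) : mark :=
  if head_src e then Head else if y \in sc G x then InnerTail else OuterTail.

Definition tgt_mark (V : finType) (G : dmg V) (x : V) (e : edge) (y : V) : mark :=
  src_mark G y (rev_edge e) x.

(** [owalk G K N n x a b y] is a walk of [n > 0] edges from [x] to [y], with mark
    [a] at [x] and mark [b] at [y].  Recording the two outer marks is enough to
    decide whether two walks may be concatenated, whichever nodes they visit. *)
Inductive owalk (V : finType) (G : dmg V) (K N : {set V}) :
    nat -> V -> mark -> mark -> V -> Prop :=
| OwalkEdge x e y : dmg_step G x e y ->
    owalk G K N 1 x (src_mark G x e y) (tgt_mark G x e y) y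
| OwalkSnoc n x a b y e z : owalk G K N n x a b y -> dmg_step G y e z ->
    passes K N y b (src_mark G y e z) ->
    owalk G K N n.+1 x a (tgt_mark G y e z) z.

Section Walks.
Variables (V : finType) (G : dmg V).
Implicit Types (K N C : {set V}) (a b c d : mark).

Lemma passesC K N v b c : passes K N v b c = passes K N v c b.
Proof. by case: b; case: c. Qed.

Lemma passes_sub K K' N N' v b c : K \subset K' -> N \subset N' ->
  passes K N v b c -> passes K' N' v b c.
Proof. by move=> /subsetP KK' /subsetP NN'; case: b; case: c => //=; auto. Qed.

Lemma rev_edgeK : involutive rev_edge.
Proof. by case. Qed.

Lemma tgt_mark_rev x e y : tgt_mark G y (rev_edge e) x = src_mark G x e y.
Proof. by rewrite /tgt_mark rev_edgeK. Qed.

Lemma owalk_sub K K' N N' n x a b y : K \subset K' -> N \subset N' ->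
  owalk G K N n x a b y -> owalk G K' N' n x a b y.
Proof.
move=> KK' NN'; elim=> {n x a b y} [x e y|n x a b y e z _ IH]; first exact: OwalkEdge.
by move=> yz /(passes_sub KK' NN'); apply: OwalkSnoc.
Qed.

Lemma owalk_cat K N n m x a b y c d z :
  owalk G K N n x a b y -> owalk G K N m y c d z -> passes K N y b c ->
  owalk G K N (n + m) x a d z.
Proof.
move=> xy yz; elim: yz xy => {m y c d z} [y e z|m y c d z e w _ IH] => [yz|].
  by move=> xy okb; rewrite addn1; apply: OwalkSnoc okb.
move=> zw okd xy okb; rewrite addnS; apply: OwalkSnoc okd => //.
exact: IH.
Qed.

Lemma owalk_rev K N n x a b y :
  owalk G K N n x a b y -> owalk G K N n y b a x.
Proof.
elim=> {n x a b y} [x e y|n x a b y e z _ IH] step.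
  by rewrite -(tgt_mark_rev x); apply: OwalkEdge; rewrite step_rev.
move=> ok; rewrite -add1n; apply: owalk_cat IH _; last by rewrite passesC; exact: ok.
by rewrite -(tgt_mark_rev y); apply: OwalkEdge; rewrite step_rev.
Qed.

Lemma owalk_gt0 K N n x a b y : owalk G K N n x a b y -> 0 < n.
Proof. by case. Qed.

(** A walk that starts with a tail follows directed edges until it meets a
    collider or ends. *)
Lemma owalk_tail_step K N n x a b y :
  (forall u v, u \in an G v -> v \in K -> u \in K) ->
  owalk G K N n x a b y -> a <> Head ->
  exists2 w, (x, w) \in dir G & w \in K \/ w \in an G y /\ b = Head.
Proof.
move=> clK; elim=> {n x a b y} [x e y|n x a b y e z _ IH].
  by case: e => //= xy _; exists y => //; right; rewrite an_refl.
move=> yz pass_y /IH[w xw wK]; exists w => //.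
case: wK => [|[wy bE]]; [by left | rewrite {}bE in pass_y].
case: e yz pass_y => //= yz yK; last 2 first.
- by left; apply: clK wy yK.
- by left; apply: clK wy yK.
by right; split=> //; apply: an_trans wy (dir_an yz).
Qed.

Lemma owalk_tail K N n x a b y :
  (forall u v, u \in an G v -> v \in K -> u \in K) ->
  owalk G K N n x a b y -> a <> Head -> x \in K \/ x \in an G y /\ b = Head.
Proof.
move=> clK xy /(owalk_tail_step clK xy)[w /dir_an xw [wK|[wy bE]]].
  by left; apply: clK xw wK.
by right; split=> //; apply: an_trans xw wy.
Qed.

(** A nontrivial directed path is a walk all of whose inner nodes are
    non-colliders; they pass if they stay in one component or lie in [N]. *)
Lemma directed_owalk K N k x :
  (forall v w, k \in an G v -> (v, w) \in dir G -> w \in an G x ->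
     w \in sc G v \/ v \in N) ->
  k \in an G x -> k != x ->
  exists n w, [/\ (k, w) \in dir G, w \in an G x &
    owalk G K N n k (src_mark G k To w) Head x].
Proof.
move=> inN kx neq_kx.
pose reach v := v \in an G x -> k = v \/
  exists n w, [/\ (k, w) \in dir G, w \in an G x &
    owalk G K N n k (src_mark G k To w) Head v].
suff: reach x by case/(_ (an_refl G x)) => // kx'; rewrite kx' eqxx in neq_kx.
have: x \in de G k by rewrite inE.
apply: an_ind_right; first by left.
move=> v w kv vw IH wx; right.
have [kv'|[n [u [ku ux kuv]]]] := IH (an_trans (dir_an vw) wx).
  exists 1, w; rewrite kv'; split=> //.
  exact: (@OwalkEdge _ _ _ _ v To w).
exists n.+1, u; split=> //; apply: (@OwalkSnoc _ _ _ _ _ _ _ _ _ To) kuv (vw) _.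
rewrite /src_mark /=; case: ifP => // /negbT nsc.
by case: (inN v w kv vw wx) => // vw_sc; rewrite vw_sc in nsc.
Qed.

End Walks.

(** * Connection given a set *)

(** The disjunct [x = y] accounts for the trivial walk, which [owalk] excludes. *)
Definition connected (V : finType) (G : dmg V) (C : {set V}) (x y : V) : Prop :=
  [/\ x \notin C, y \notin C &
      x = y \/ exists n a b, owalk G (anS G C) (~: C) n x a b y].

Section Connection.
Variables (V : finType) (G : dmg V).
Implicit Types (x y z v w : V) (K N C : {set V}) (a b c d : mark).

(** A collider [y] that is an ancestor of the source [x] but not of [C] can be
    reached from [x] against a directed path from [y] to [x], which avoids [C];
    this replaces the part of the walk before [y] and turns [y] into a
    non-collider. *)
Lemma drop_source_colliders K C n x a b y : anS G C \subset K ->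
  owalk G (K :|: an G x) (~: C) n x a b y ->
  exists m a', owalk G K (~: C) m x a' b y.
Proof.
move=> /subsetP CK; move eqA: (an G x) => A xy.
elim: xy eqA => {n x a b y} [x e y|n x a b y e z _ IH] step.
  by exists 1, (src_mark G x e y); apply: OwalkEdge.
move=> pass_y xA; have [m [a' xy]] := IH xA; clear IH; rewrite -xA in pass_y.
have [ok|ok] := boolP (passes K (~: C) y b (src_mark G y e z)).
  by exists m.+1, a'; apply: OwalkSnoc ok.
have tgt_z : owalk G K (~: C) 1 y (src_mark G y e z) (tgt_mark G y e z) z.
  exact: OwalkEdge.
move: xy ok pass_y tgt_z; case: b => //=; case: (src_mark G y e z) => //= xy yK yAx yz;
  try by rewrite yAx in yK.
  move: yAx; rewrite inE (negPf yK) => yx; have [yx'|neq_yx] := eqVneq y x.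
    by exists 1, Head; rewrite -yx'.
  (* The directed path from y to x consists of descendants of y, none of which
     is in C, as y is not an ancestor of C. *)
  have anC v : y \in an G v -> v \notin C.
    move=> yv; apply/negP => vC; move/negP: yK; apply; apply: CK.
    by apply/in_anS; exists v.
  have [k [w [_ _ /owalk_rev xy']]] : exists n w, [/\ (y, w) \in dir G, w \in an G x &
      owalk G K (~: C) n y (src_mark G y To w) Head x].
    by apply: directed_owalk => // v w yv _ _; right; rewrite inE anC.
  exists (k + 1), Head; apply: owalk_cat xy' yz _.
  by rewrite /src_mark /=; case: ifP => //= _; rewrite inE anC ?an_refl.
Qed.

(** Colliders may be ancestors of the ends instead of [C]: those of one end are
    removed first, then, after reversing the walk, those of the other. *)
Lemma connected_of_owalk K N C n x a b y :
  K \subset anS G C :|: (an G x :|: an G y) -> N \subset ~: C ->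
  x \notin C -> y \notin C -> owalk G K N n x a b y -> connected G C x y.
Proof.
move=> Ksub Nsub xC yC xy; split=> //; right.
have Ksub' : K \subset anS G C :|: an G y :|: an G x by rewrite -setUA [an G y :|: _]setUC.
have [m [a' /owalk_rev xy']] := drop_source_colliders (subsetUl _ _) (owalk_sub Ksub' Nsub xy).
have [m' [b' xy'']] := drop_source_colliders (subxx _) xy'.
exists m', a', b'; exact: owalk_rev xy''.
Qed.

(** The counterpart of [owalk] on explicit sequences of edges; [m] is the mark
    with which [x] has been entered, if any. *)
Fixpoint open_seq K N x (m : option mark) (s : seq (edge * V)) : bool :=
  if s is (e, y) :: s' then
    [&& dmg_step G x e y,
        if m is Some b then passes K N x b (src_mark G x e y) else true &
        open_seq K N y (Some (tgt_mark G x e y)) s']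
  else true.

Definition visit_passes K N (t : visit V) : bool :=
  passes K N (node t) (tgt_mark G (prev_node t) (edge_in t) (node t))
    (src_mark G (node t) (edge_out t) (next_node t)).

Lemma open_seqE K N x s :
  open_seq K N x None s = is_walk (dmg_step G) x s && all (visit_passes K N) (inner x s).
Proof.
case: s => // -[e y] s /=; rewrite -!andbA; congr (_ && _).
elim: s x e y => [|[e' z] s IH] x e y //=.
by rewrite IH -!andbA; congr (_ && _); rewrite andbCA.
Qed.

Fixpoint last_mark x (m : option mark) (s : seq (edge * V)) : option mark :=
  if s is (e, y) :: s' then last_mark y (Some (tgt_mark G x e y)) s' else m.

Lemma open_seq_cat K N x m s1 s2 :
  open_seq K N x m (s1 ++ s2) =
  open_seq K N x m s1 && open_seq K N (endpoint x s1) (last_mark x m s1) s2.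
Proof.
elim: s1 x m => [|[e y] s IH] x m //=; rewrite IH -!andbA.
by [].
Qed.

Lemma last_mark_cat x m s1 s2 :
  last_mark x m (s1 ++ s2) = last_mark (endpoint x s1) (last_mark x m s1) s2.
Proof. by elim: s1 x m => [|[e y] s IH] x m /=. Qed.

Lemma open_seq_start K N x m s : open_seq K N x m s -> open_seq K N x None s.
Proof. by case: s => // -[e y] s /= /and3P[-> _ ->]. Qed.

Lemma open_seq_extend K N n z a b x s :
  owalk G K N n z a b x -> open_seq K N x (Some b) s ->
  exists2 d, last_mark x (Some b) s = Some d &
    owalk G K N (n + size s) z a d (endpoint x s).
Proof.
elim: s n b x => [|[e y] s IH] n b x zx /=; first by exists b; rewrite ?addn0.
by case/and3P=> xy pass_x /(IH _ _ _ (OwalkSnoc zx xy pass_x)); rewrite addnS.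
Qed.

Lemma open_seq_owalk K N x e y s : open_seq K N x None ((e, y) :: s) ->
  exists2 b, last_mark x None ((e, y) :: s) = Some b &
    owalk G K N (size s).+1 x (src_mark G x e y) b (endpoint y s).
Proof. by case/andP=> xy /(open_seq_extend (OwalkEdge K N xy)). Qed.

Lemma owalk_open_seq K N n x a b y : owalk G K N n x a b y ->
  exists2 s, [/\ size s = n, endpoint x s = y & last_mark x None s = Some b]
    & open_seq K N x None s.
Proof.
elim=> {n x a b y} [x e y xy|n x a b y e z _ [s [sn sy sb] os] yz ok].
  by exists [:: (e, y)] => //=; rewrite xy.
exists (s ++ [:: (e, z)]); last by rewrite open_seq_cat os sb sy /= yz ok.
rewrite size_cat sn addn1 /endpoint /unzip2 map_cat last_cat; split=> //.
by rewrite last_mark_cat /= sy.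
Qed.

End Connection.

(** * From walks to paths: sigma-separation *)

Section Paths.
Variables (V : finType) (G : dmg V).
Implicit Types (x y z v w : V) (K N C : {set V}) (a b c d : mark).
Implicit Types (s : seq (edge * V)).

Lemma all_innerP (P : pred (visit V)) x s :
  (forall s1 e v e' w s2, s = s1 ++ (e, v) :: (e', w) :: s2 ->
     P (Visit (endpoint x s1) e v e' w)) ->
  all P (inner x s).
Proof.
elim: s x => [|[e v] [|[e' w] s] IH] x //= Ps.
rewrite (Ps [::] e v e' w s) //=; apply: IH => s1 f u f' t s2 sE.
by apply: (Ps ((e, v) :: s1) f u f' t s2); rewrite sE.
Qed.

Lemma endpoint_cat x s1 s2 : endpoint x (s1 ++ s2) = endpoint (endpoint x s1) s2.
Proof. by rewrite /endpoint /unzip2 map_cat last_cat. Qed.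

Lemma repeated_node x s : ~~ uniq (x :: unzip2 s) ->
  exists s1 s2 s3, [/\ s = s1 ++ s2 ++ s3, s2 != [::] & endpoint x (s1 ++ s2) = endpoint x s1].
Proof.
elim: s x => [|[e y] s IH] x //; rewrite cons_uniq negb_and negbK => /orP[].
  move=> xs; have : x \in unzip2 ((e, y) :: s) by [].
  case/mapP=> -[f z] /splitPr[s2 s3] /= ->.
  exists [::], (rcons s2 (f, z)), s3; rewrite /= cat_rcons; split=> //.
    by case: s2.
  by rewrite -cats1 endpoint_cat.
by move/IH=> [s1 [s2 [s3 [-> ? ?]]]]; exists ((e, y) :: s1), s2, s3.
Qed.

(** Cutting out a loop at [v] with marks [c] and [d] at its two ends.  The only
    danger is that [v] becomes a collider; but then either it was one before, or
    the loop started with a tail and led to a collider below [v]. *)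
Lemma passes_bypass K N v b c d e :
  passes K N v b c -> passes K N v d e -> (c <> Head -> v \in K \/ d = Head) ->
  passes K N v b e.
Proof.
case: b c d e => [] [] [] [] //= vK vN loop.
all: by case: loop.
Qed.

(** A shortest walk is a path, because loops can be cut out. *)
Lemma owalk_path K N n x a b y :
  (forall u v, u \in an G v -> v \in K -> u \in K) ->
  x != y -> owalk G K N n x a b y ->
  exists s, [/\ is_path (dmg_step G) x s, endpoint x s = y & open_seq G K N x None s].
Proof.
move=> Kan neq_xy; elim/ltn_ind: n a b => n IH a b /owalk_open_seq[s [sn sy sb] os].
have [us|] := boolP (uniq (x :: unzip2 s)).
  by exists s; split=> //; rewrite /is_path us andbT; move: os; rewrite open_seqE => /andP[].
case/repeated_node=> s1 [s2 [s3 [sE s2n s12]]].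
have: size s1 + size s3 < n.
  by rewrite -sn sE !size_cat; case: s2 s2n {sE s12} => // *; rewrite /=; lia.
case: s2 s2n => // -[e2 y2] s2 _ in sE s12 *.
move: os sy; rewrite sE catA endpoint_cat 2!open_seq_cat s12 last_mark_cat -andbA.
(* If the loop sits at an end of the walk, what remains is a part of the walk. *)
case: s1 s12 {sE} => [|[e1 y1] s1] s12 /and3P[os1 os2 os3] sy ltn.
  case: s3 sy os3 ltn => [/eqP|[e3 y3] s3 sy /open_seq_start]; first by rewrite (negPf neq_xy).
  by case/open_seq_owalk=> d _ xy ltn; apply: (IH _ ltn); rewrite -sy; exact: xy.
have [b1 m1 xv] := open_seq_owalk os1.
case: s3 sy os3 ltn => [|[e3 y3] s3] sy os3 ltn.
  by rewrite addn0 in ltn; apply: (IH _ ltn); rewrite -sy; exact: xv.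
set v := endpoint x ((e1, y1) :: s1) in s12 sy os2 os3 xv.
have [d2 m2] := open_seq_owalk (open_seq_start os2).
have [d3 _ vy] := open_seq_owalk (open_seq_start os3).
have -> : endpoint y2 s2 = v by rewrite -s12 endpoint_cat.
move=> vv.
have loop_tail : src_mark G v e2 y2 <> Head -> v \in K \/ d2 = Head.
  by case/(owalk_tail Kan vv) => [|[]]; [left|right].
move: os2 os3; rewrite m1 (m2 : last_mark G v (Some b1) ((e2, y2) :: s2) = _) /=.
move=> /and3P[_ pass1 _] /and3P[_ pass2 _] {vv}.
apply: (IH _ ltn); rewrite -sy; apply: owalk_cat xv vy _.
apply: passes_bypass pass1 pass2 loop_tail.
Qed.

Definition visit_steps (t : visit V) : bool :=
  dmg_step G (prev_node t) (edge_in t) (node t) &&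
  dmg_step G (node t) (edge_out t) (next_node t).

Lemma eq_all_inner (P Q : pred (visit V)) x s :
  (forall t, visit_steps t -> P t = Q t) -> is_walk (dmg_step G) x s ->
  all P (inner x s) = all Q (inner x s).
Proof.
move=> PQ; elim: s x => [|[e y] [|[e' z] s] IH] x //= /and3P[xy yz zs].
by rewrite PQ /visit_steps /= ?xy ?yz // IH //= yz.
Qed.

Lemma visit_passesE K N t : visit_steps t ->
  visit_passes G K N t =
    if collider t then node t \in K else leaves_sc G t ==> (node t \in N).
Proof.
case: t => u e v f w /andP[/= uv vw]; rewrite /visit_passes /collider /leaves_sc /=.
by case: e uv => // uv; case: f vw => // vw; rewrite /tgt_mark /src_mark /=; do ?case: ifP.
Qed.

Lemma open_seq_blocked C x s : is_walk (dmg_step G) x s -> x \notin C -> endpoint x s \notin C ->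
  sigma_blocked G C x s = ~~ open_seq G (anS G C) (~: C) x None s.
Proof.
move=> xs xC yC; rewrite open_seqE xs /sigma_blocked (negPf xC) (negPf yC) /=.
rewrite -[LHS]negbK !negb_or -!all_predC -all_predI; congr (~~ _).
apply: eq_all_inner xs => t /visit_passesE ->; rewrite /= inE.
by case: (collider t); rewrite ?negbK ?andbT //=; case: (leaves_sc G t); case: (_ \in C).
Qed.

Lemma sigma_separatedP A B C :
  sigma_separated G A B C <-> (forall x y, x \in A -> y \in B -> ~ connected G C x y).
Proof.
split=> [sepG x y xA yB [xC yC conn]|sepG x s xs xA yB].
  have [s [xs sy]] : exists s, [/\ is_path (dmg_step G) x s, endpoint x s = y &
      open_seq G (anS G C) (~: C) x None s].
    have [->|neq_xy] := eqVneq x y; first by exists [::].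
    case: conn => [/eqP|[n [a [b xy]]]]; first by rewrite (negPf neq_xy).
    by apply: owalk_path neq_xy xy => u v uv; apply: anS_closed uv.
  have := sepG x s xs xA; rewrite sy => /(_ yB).
  by case/andP: xs => xs _; rewrite open_seq_blocked ?sy // => /negPf->.
case/andP: xs => xs _.
have [xC|xC] := boolP (x \in C); first by rewrite /sigma_blocked xC.
have [yC|yC] := boolP (endpoint x s \in C); first by rewrite /sigma_blocked yC orbT.
rewrite open_seq_blocked //; apply/negP => os; apply: (sepG _ _ xA yB); split=> //.
case: s os {xs yB yC} => [|[e y] s] os; [by left | right].
have [b _ xy] := open_seq_owalk os.
by exists (size s).+1, (src_mark G x e y), b.
Qed.

Lemma in_IM A B C :
  ((A, B, C) \in IM G) <-> (forall x y, x \in A -> y \in B -> ~ connected G C x y).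
Proof. by rewrite -sigma_separatedP inE /=; split=> [/asboolP|sepG] //; apply/asboolP. Qed.

End Paths.

(** The independence model consists of the separations of single nodes; taking
    singletons for the first two sets recovers them. *)
Lemma markov_equivP (V : finType) (G1 G2 : dmg V) :
  markov_equiv G1 G2 <-> (forall C x y, connected G1 C x y <-> connected G2 C x y).
Proof.
split=> [eqIM C x y|eqC].
  have sep1 G : ([set x], [set y], C) \in IM G <-> ~ connected G C x y.
    rewrite in_IM; split=> [|nxy _ _ /set1P-> /set1P->] //.
    by apply; rewrite set11.
  have nE : ~ connected G1 C x y <-> ~ connected G2 C x y by rewrite -!sep1 eqIM.
  by split=> h; apply: contrapT; [rewrite -nE|rewrite nE]; apply.
apply/setP => -[[A B] C]; apply/idP/idP => /in_IM h; apply/in_IM => x y xA yB /eqC; exact: h.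
Qed.

(** * Inducing paths and inseparability *)

(** Inducing walks instead of inducing paths: unlike paths, they can be
    concatenated freely. *)
Definition inducing_link (V : finType) (G : dmg V) (x y : V) : Prop :=
  exists n a b, owalk G (an G x :|: an G y) set0 n x a b y.

Section Inducing.
Variables (V : finType) (G : dmg V).
Implicit Types (x y z v w : V) (K N C : {set V}) (a b c d : mark).

Lemma inducing_seqE x s :
  inducing_path G x s =
  is_path (dmg_step G) x s && open_seq G (an G x :|: an G (endpoint x s)) set0 x None s.
Proof.
rewrite /inducing_path open_seqE; case xs: (is_path _ x s) => //=.
case/andP: xs => xs _; rewrite xs /=; apply: eq_all_inner xs => t /visit_passesE->.
by rewrite anS2 in_set0 implybF.
Qed.

Lemma link_connected x y C : inducing_link G x y -> x \notin C -> y \notin C ->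
  connected G C x y.
Proof.
case=> n [a [b xy]] xC yC; apply: connected_of_owalk xy => //; first exact: subsetUr.
exact: sub0set.
Qed.

(** Nodes joined by an inducing walk cannot be separated, since its colliders are
    ancestors of the ends.  Conversely, take a path that is open given the
    proper ancestors of [x] and [y].  Its colliders are ancestors of [x] or [y].
    A non-collider with a tail leads along directed edges to a collider or an
    end, so it is a proper ancestor of [x] or [y] too; as the path is open, its
    outgoing edges stay in its component. *)
Lemma inducing_pathP x y : x != y ->
  [<-> inducing_link G x y;
       forall C, x \notin C -> y \notin C -> connected G C x y;
       connected G ((an G x :|: an G y) :\ x :\ y) x y;
       exists2 s, inducing_path G x s & endpoint x s = y].
Proof.
move=> neq_xy; tfae.
- by move=> xy C; apply: link_connected.
- by apply; rewrite !in_setD1 eqxx ?andbF.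
- set A := an G x :|: an G y; set C := _ :\ y.
  case=> xC yC [/eqP|]; first by rewrite (negPf neq_xy).
  case=> n [a [b xy]].
  have anCA : anS G C \subset A.
    apply/subsetP=> v /in_anS[c cC vc]; apply: anU_closed vc _.
    by move: cC; rewrite !in_setD1 => /and3P[].
  have [s [xs sy os]] := owalk_path (fun u v => @anS_closed _ G C u v) neq_xy xy.
  exists s => //; rewrite inducing_seqE xs sy /=.
  case/andP: xs => xs us; move: (os); rewrite !open_seqE xs /= => _.
  apply: all_innerP => s1 e v f w s2 sE.
  move: os us sy; rewrite sE -cat_rcons open_seq_cat endpoint_cat /unzip2 map_cat => /andP[os1 os2].
  have {s sE xs} [v1 u1 m1] : [/\ endpoint x (rcons s1 (e, v)) = v, v \in unzip2 (rcons s1 (e, v)) &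
      last_mark G x None (rcons s1 (e, v)) = Some (tgt_mark G (endpoint x s1) e v)].
    by rewrite -cats1 endpoint_cat last_mark_cat /unzip2 map_cat mem_cat mem_head orbT.
  rewrite v1 m1 in os2 *; rewrite -cat_cons cat_uniq => /and3P[us1 us2 _] sy.
  have neq_vx : v != x by move: us1; rewrite /= => /andP[+ _]; apply: contraNneq => <-.
  have neq_vy : v != y.
    apply: contraNneq us2 => vy; apply/hasP; exists y; last by rewrite -vy inE u1 orbT.
    by rewrite -sy /endpoint /= mem_last.
  have [n2 [d vy]] : exists n d, owalk G (anS G C) (~: C) n v (src_mark G v f w) d y.
    by have [d _] := open_seq_owalk (open_seq_start os2); rewrite -sy; exists (size s2).+1, d.
  have [n1 [a1 xv]] : exists n a, owalk G (anS G C) (~: C) n x a (tgt_mark G (endpoint x s1) e v) v.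
    case: (rcons _ _) v1 m1 os1 {us1 us2 u1} => // -[e1 y1] s' v1 m1 /open_seq_owalk[b1].
    rewrite m1 (v1 : endpoint y1 s' = v) => -[<-] xv.
    by exists (size s').+1, (src_mark G x e1 y1).
  case/and3P: os2 => _; rewrite -/(visit_passes _ _ _ (Visit _ _ _ _ _)) => pass_v _.
  have vC : v \in A -> v \in C by rewrite !in_setD1 neq_vx neq_vy.
  have srcA : src_mark G v f w <> Head -> v \in C.
    move=> tl; apply: vC; have [|/(subsetP anCA)|[vy' _]] // := owalk_tail _ vy tl.
      by move=> u t ut; apply: anS_closed ut.
    by rewrite in_setU vy' orbT.
  have tgtA : tgt_mark G (endpoint x s1) e v <> Head -> v \in C.
    move=> tl; apply: vC; have [|/(subsetP anCA)|[vy' _]] // := owalk_tail _ (owalk_rev xv) tl.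
      by move=> u t ut; apply: anS_closed ut.
    by rewrite in_setU vy'.
  move: pass_v srcA tgtA; rewrite /visit_passes /=.
  by case: (tgt_mark _ _ _ _); case: (src_mark _ _ _ _) => //=;
    first [by move/(subsetP anCA) | rewrite in_setC => /negP vnC sA tA; case: vnC;
      by [exact: sA | exact: tA]].
- case=> s; rewrite inducing_seqE => /andP[xs os] sy.
case: s os sy {xs} => [_ /eqP|[e z] s os sy]; first by rewrite (negPf neq_xy).
have [b _ xy] := open_seq_owalk os; rewrite -sy.
by exists (size s).+1, (src_mark G x e z), b.
Qed.
End Inducing.

(** * Acyclifications preserve the independence model *)

(** [InnerTail] is the least restrictive mark: whatever passes with another mark
    passes with [InnerTail] in its place. *)
Definition weakens (m m' : mark) : Prop := m = m' \/ m = InnerTail.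

Lemma passes_weakens (V : finType) (K N : {set V}) v a b c d :
  weakens a b -> weakens c d -> passes K N v b d -> passes K N v a c.
Proof. by case=> -> [] ->; case: b; case: d. Qed.

Lemma acyclic_src_mark (V : finType) (G : dmg V) x e y : acyclic G ->
  dmg_step G x e y -> src_mark G x e y = if head_src e then Head else OuterTail.
Proof.
move=> acG xy; rewrite /src_mark; case: ifP => // _; case: ifP => // /(acyclic_sc acG) yx.
by move: (step_neq xy); rewrite yx eqxx.
Qed.

Section FromAcyclification.
Variables (V : finType) (G G' : dmg V).
Hypothesis acyG : acyclification G G'.
Implicit Types (x y z u v w : V) (K N C : {set V}) (a b c d : mark).

Lemma an_acyclification x y : x \in an G' y -> x \in an G y.
Proof.
case: acyG => _ dirG' _ _; elim/an_ind_left => [|v w vw _ wy]; first exact: an_refl.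
apply: an_trans wy; have [|/dirG'] := boolP (v \in sc G w).
  by rewrite scE => /andP[].
case=> /(_ vw)[w' + vw'] _; rewrite scE => /andP[w'w _].
exact: an_trans (dir_an vw') w'w.
Qed.

Lemma anS_acyclification C : anS G' C \subset anS G C.
Proof.
apply/subsetP => x /in_anS[c cC /an_acyclification xc].
by apply/in_anS; exists c.
Qed.

Lemma sc_owalk K N x y : x \in sc G y -> x != y ->
  exists n, owalk G K N n x InnerTail Head y.
Proof.
rewrite scE => /andP[xy yx] neq_xy.
have [v w xv vw wy|n [w [xw wy xy_walk]]] := @directed_owalk _ G K N x y _ xy neq_xy.
  left; rewrite scE (dir_an vw) andbT; apply: an_trans wy _.
  exact: an_trans yx xv.
exists n; move: xy_walk; rewrite /src_mark /= scE (dir_an xw) andbT.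
by rewrite (an_trans wy yx).
Qed.

Lemma owalk_extend_head K N n x a y z : owalk G K N n x a Head y -> z \in sc G y ->
  exists m, owalk G K N m x a Head z.
Proof.
move=> xy; rewrite sc_sym; have [<- _|neq_yz yz] := eqVneq y z; first by exists n.
have [m yz_walk] := sc_owalk K N yz neq_yz.
by exists (n + m); apply: owalk_cat xy yz_walk _.
Qed.

(** An edge of the acyclification between two components comes from an edge of
    [G] between the same components, extended at its arrowheads by directed
    walks inside them.  An edge inside a component may be realised by a directed
    walk, whatever its type, as the only mark that changes becomes
    [InnerTail]. *)
Lemma acyclification_edge_owalk K N x e y : dmg_step G' x e y ->
  exists n a b, [/\ owalk G K N n x a b y, weakens a (src_mark G' x e y) &
    weakens b (tgt_mark G' x e y)].
Proof.
case: acyG => acG' dirG' biG' _.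
have dirW u v : (u, v) \in dir G' -> exists n a b,
    [/\ owalk G K N n u a b v, weakens a OuterTail & b = Head].
  move=> uv; have [uv_sc|/dirG'] := boolP (u \in sc G v).
    have [n uvW] := sc_owalk K N uv_sc (dir_neq uv).
    by exists n, InnerTail, Head; split=> //; right.
  case=> /(_ uv)[v' v'v uv'] _.
  have uv'W : owalk G K N 1 u (src_mark G u To v') Head v' by exact: (@OwalkEdge _ _ _ _ u To v').
  have [n uvW] := owalk_extend_head uv'W (etrans (sc_sym G v v') v'v).
  exists n, (src_mark G u To v'), Head; split=> //; rewrite /src_mark /=.
  by case: ifP; [right | left].
move=> xy; have xM := acyclic_src_mark acG' xy.
have yM : tgt_mark G' x e y = if head_tgt e then Head else OuterTail.
  by rewrite [LHS](acyclic_src_mark acG') ?step_rev //; case: (e).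
rewrite {}xM {}yM; case: e xy => //= [xy|yx|xy].
- have [n [a [b [xyW aw bE]]]] := dirW _ _ xy.
  by subst b; exists n, a, Head; split=> //; left.
- have [n [a [b [yxW aw bE]]]] := dirW _ _ yx.
  by subst b; exists n, Head, a; split=> //; [exact: owalk_rev | left].
have [xy_sc|/biG'] := boolP (x \in sc G y).
  have [n xyW] := sc_owalk K N xy_sc (@step_neq _ G' x Bidir y xy).
  by exists n, InnerTail, Head; split; [|right|left].
case=> /(_ xy)[x' [y' [xx' yy' x'y']]] _.
have x'y'W : owalk G K N 1 x' Head Head y' by exact: (@OwalkEdge _ _ _ _ x' Bidir y').
rewrite sc_sym in xx'; rewrite sc_sym in yy'.
have [n x'yW] := owalk_extend_head x'y'W yy'.
have [m yxW] := owalk_extend_head (owalk_rev x'yW) xx'.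
by exists m, Head, Head; split; [exact: owalk_rev|left|left].
Qed.

Lemma acyclification_owalk C N n x a b y : owalk G' (anS G' C) N n x a b y ->
  exists m a' b', [/\ owalk G (anS G C) N m x a' b' y, weakens a' a & weakens b' b].
Proof.
elim=> {n x a b y} [x e y|n x a b y e z _ [m [a' [b' [xy aw bw]]]] yz pass_y].
  exact: acyclification_edge_owalk.
have [k [c [d [yzW cw dw]]]] := acyclification_edge_owalk (anS G C) N yz.
exists (m + k), a', d; split=> //; apply: owalk_cat xy yzW _.
apply: passes_weakens bw cw _.
exact: passes_sub (anS_acyclification C) (subxx _) pass_y.
Qed.

Lemma acyclification_connected_of C x y : connected G' C x y -> connected G C x y.
Proof.
case=> xC yC conn; split=> //; case: conn => [->|[n [a [b]]]]; first by left.
by case/acyclification_owalk=> m [a' [b' [xy _ _]]]; right; exists m, a', b'.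
Qed.

(** Only the node of the component of [v] at which a directed path to [C] leaves
    the component, or ends, is sure to be an ancestor of [C] in the acyclification. *)
Lemma anS_acyclification_sc C v : v \in anS G C ->
  exists2 w, w \in sc G v & w \in anS G' C.
Proof.
case: acyG => _ dirG' _ _ /in_anS[c cC]; elim/an_ind_left => [|u w uw _ [w' w'w w'C]].
  by exists c; rewrite ?sc_refl ?(subsetP (sub_anS _ _)).
have [uw_sc|uw_sc] := boolP (u \in sc G w).
  by exists w'; rewrite // (sc_trans w'w) // sc_sym.
exists u; first exact: sc_refl.
apply: anS_closed w'C; apply: dir_an; apply/dirG'.
  by apply: contra uw_sc => uw'; apply: sc_trans uw' w'w.
by exists w => //; rewrite sc_sym.
Qed.

Section Reach.
Variables (C : {set V}) (x : V).
Hypothesis xC : x \notin C.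

(** [reached v b]: an open walk of the acyclification leads from [x] to [v], with
    mark [b] at [v].  A walk with a head at a node of a component, coming from
    outside, can be redirected to any node of that component; a tail cannot be
    moved. *)
Definition reached v b : Prop :=
  exists n a, owalk G' (anS G' C) (~: C) n x a b v.

Definition reached_by_tail v : Prop := v = x \/ exists2 b, b <> Head & reached v b.

(** The invariant for an open walk of [G] from [x] that is at [v] with mark [b].
    Either its component has been entered by a head, and then every node of it
    is reached by a head; if [b] is no head, a collider has been met inside the
    component, which makes the component consist of ancestors of [C].  Or the
    component has been entered by a tail at some [u], or contains the start [u];
    [u] is then known to be outside [C], unless it has just been entered. *)
Definition reached_sc v b : Prop :=
  ((forall w, w \in sc G v -> reached w Head) /\ (b <> Head -> v \in anS G C)) \/
  (exists2 u, u \in sc G v & reached_by_tail u /\ (u \notin C \/ u = v /\ b = OuterTail)).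

Lemma reached_step v b e w : reached v b -> dmg_step G' v e w ->
  passes (anS G' C) (~: C) v b (src_mark G' v e w) -> reached w (tgt_mark G' v e w).
Proof. by move=> [n [a xv]] vw pass_v; exists n.+1, a; apply: OwalkSnoc pass_v. Qed.

Lemma reached_by_tail_step v e w : reached_by_tail v -> v \notin C -> dmg_step G' v e w ->
  reached w (tgt_mark G' v e w).
Proof.
case=> [->|[b bT xv]] vC vw.
  by exists 1, (src_mark G' x e w); apply: OwalkEdge.
by apply: reached_step xv vw _; case: b bT (src_mark _ _ _ _) => [] // _ [] //=; rewrite inE.
Qed.

Lemma acyclification_sc_edge u v : u \in sc G v -> u != v -> exists e, dmg_step G' u e v.
Proof.
case: acyG => _ _ _ scG' uv neq_uv.
by case: (scG' u v neq_uv uv) => uv'; [exists To | exists From | exists Bidir].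
Qed.

(** From the entry point [u] an edge of the acyclification inside the component
    leads to [v]. *)
Lemma reached_scW v b : reached_sc v b -> v \notin C -> reached_by_tail v \/ exists d, reached v d.
Proof.
case=> [[/(_ v (sc_refl G v)) vR _] _|[u uv [uR uC] vC]]; first by right; exists Head.
have [<-|neq_uv] := eqVneq u v; first by left.
have [e uv'] := acyclification_sc_edge uv neq_uv; right; exists (tgt_mark G' u e v).
by apply: reached_by_tail_step uv' => //; case: uC => // -[uvE]; rewrite uvE in vC *.
Qed.

(** Inside a component nothing needs to be done.  When the walk leaves by a tail
    at [v], the node [v] is outside [C] and the same edge is taken after going to
    [v].  When it leaves by a head at [v], the edge can be attached at any node
    [p] of the component: the entry point [u], which then is a non-collider, or,
    if the component was entered by a head, a node that is an ancestor of [C] in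
    the acyclification, which then is a collider. *)
Lemma reached_sc_step v b e w : reached_sc v b -> dmg_step G v e w ->
  passes (anS G C) (~: C) v b (src_mark G v e w) -> reached_sc w (tgt_mark G v e w).
Proof.
case: (acyG) => acG' dirG' biG' _ vR vw pass_v.
have vC : b = OuterTail \/ src_mark G v e w = OuterTail -> v \notin C.
  by move: pass_v; rewrite -in_setC; case: (b); case: (src_mark _ _ _ _) => //= ? [].
have v_an : b = Head -> head_src e -> v \in anS G C.
  by move: pass_v => /[swap] -> /=; rewrite /src_mark => /[swap] ->.
have [wv|w_v] := boolP (w \in sc G v).
  case: vR => [[scR v_anS]|[u uv [uR uC]]].
    left; split=> [t tw|wT]; first exact: scR (sc_trans tw wv).
    apply: anS_closed (_ : w \in an G v) _; first by move: wv; rewrite scE => /andP[].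
    have he : head_src e by case: (e) vw wT.
    have [bH|bH] : b = Head \/ b <> Head by case: (b); [left|right|right].
      exact: v_an.
    exact: v_anS.
  right; exists u; first by rewrite (sc_trans uv) // sc_sym.
  by split=> //; left; case: uC => // -[-> bO]; apply: vC; left.
have w_v' : v \notin sc G w by rewrite sc_sym.
have scN p t : p \in sc G v -> t \in sc G w -> p \notin sc G t.
  move=> pv tw; apply: contra w_v' => pt.
  by apply: sc_trans (sc_trans pt tw); rewrite sc_sym.
case head_e: (head_src e).
  have [p pv pR] : exists2 p, p \in sc G v & forall e' t, dmg_step G' p e' t ->
      head_src e' -> reached t (tgt_mark G' p e' t).
    case: vR => [[scR v_anS]|[u uv [uR uC]]].
      have /anS_acyclification_sc[p pv pC] : v \in anS G C.
        by case: (b) v_an v_anS => [vA _|_|_]; [exact: vA | apply | apply].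
      exists p => // e' t pt he'; apply: reached_step pt _; first exact: scR.
      by rewrite /src_mark he'.
    exists u => // e' t ut he'; apply: reached_by_tail_step ut => //.
    by case: uC => // -[-> bO]; apply: vC; left.
  case: e head_e vw {pass_v vC v_an} => // _ vw.
    have pw : (w, p) \in dir G'.
      by apply/dirG'; [rewrite sc_sym scN ?sc_refl | exists v; rewrite // sc_sym].
    right; exists w; first exact: sc_refl.
    split; last by right; rewrite /tgt_mark /src_mark /= (negPf w_v').
    right; exists (tgt_mark G' p From w); last exact: pR.
    by rewrite [tgt_mark _ _ _ _](@acyclic_src_mark _ G' w To p acG').
  left; split=> // t tw; apply: (pR Bidir t) => //=.
  by apply/biG'; [exact: scN | exists v, w; rewrite sc_sym pv sc_sym tw].
case: e head_e vw {pass_v v_an} vC => // _ vw vC.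
have {}vC : v \notin C by apply: vC; right; rewrite /src_mark /= (negPf w_v).
left; split=> // t tw.
have vt : (v, t) \in dir G'.
  by apply/dirG'; [rewrite scN ?sc_refl | exists w; rewrite // sc_sym].
have [vT|[d vd]] := reached_scW vR vC; first exact: (reached_by_tail_step vT vC (e := To)).
apply: (reached_step vd (e := To)) => //.
by rewrite (@acyclic_src_mark _ G' v To t) //=; case: (d) => /=; rewrite inE.
Qed.

Lemma owalk_reached_sc n a b y : owalk G (anS G C) (~: C) n x a b y -> reached_sc y b.
Proof.
(* With InnerTail as the mark at the start, the only restriction on the first
   edge is that x is not in C. *)
have xR : reached_sc x InnerTail.
  by right; exists x; [exact: sc_refl | split; left].
suff gen z : owalk G (anS G C) (~: C) n z a b y -> z = x -> reached_sc y b by move/gen; apply.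
elim=> {n z a b y} [z e y zy zx|n z a b y e w _ IH yw pass_y zx].
  rewrite {}zx in zy *; apply: reached_sc_step xR zy _ => /=.
  by case: (src_mark _ _ _ _) => //=; rewrite inE.
exact: reached_sc_step (IH zx) yw pass_y.
Qed.
End Reach.

Lemma acyclification_connected C x y : connected G C x y <-> connected G' C x y.
Proof.
split; last exact: acyclification_connected_of.
case=> xC yC [->|[n [a [b /(owalk_reached_sc xC) yR]]]]; split=> //; first by left.
have [[->|[d _ [m [c xy]]]]|[d [m [c xy]]]] := reached_scW yR yC; first by left.
  by right; exists m, c, d.
by right; exists m, c, d.
Qed.
End FromAcyclification.

Lemma acyclification_markov_equiv (V : finType) (G G' : dmg V) :
  acyclification G G' -> markov_equiv G' G.
Proof.
move=> acyG; apply/markov_equivP => C x y.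
exact: iff_sym (acyclification_connected acyG C x y).
Qed.

(** * Ancestral relations excluded by the independence model *)

(** Adding [x] to a separating set destroys the separation of [i] and [j]; this
    can be read off from the independence model. *)
Definition noncause (V : finType) (G : dmg V) (x t : V) : Prop :=
  exists i j C, [/\ ~ connected G C i j, connected G (x |: C) i j &
    t \in i |: (j |: C)].

Section Noncause.
Variables (V : finType) (G : dmg V).
Implicit Types (x y z u v w t i j : V) (K N C : {set V}) (a b c d : mark).

(** If [x] were an ancestor of [i], [j] or [C], every collider that is an
    ancestor of [x] would be an ancestor of one of them, so a walk that is open
    given [x |: C] would already connect [i] and [j] given [C]. *)
Lemma noncause_an x t : noncause G x t -> x \notin an G t.
Proof.
case=> i [j [C [nij [iC jC ij] tC]]]; apply/negP => xt; apply: nij.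
have [iC' jC'] : i \notin C /\ j \notin C.
  by split; [apply: contra iC | apply: contra jC]; rewrite in_setU1 orbC => ->.
case: ij => [->|[n [a [b ij]]]]; first by split=> //; left.
apply: connected_of_owalk ij => //; last by rewrite setCS subsetUr.
apply/subsetP => v /in_anS[c /setU1P[->|cC] vc]; rewrite in_setU; last first.
  by apply/orP; left; apply/in_anS; exists c.
have vt := an_trans vc xt.
case/setU1P: tC vt => [->|/setU1P[->|tC]] vt; rewrite ?in_setU ?vt ?orbT //.
by apply/orP; left; apply/in_anS; exists t.
Qed.

Lemma noncause_equiv (G' : dmg V) x t : markov_equiv G' G -> noncause G x t -> noncause G' x t.
Proof.
move=> /markov_equivP eqC [i [j [C [nij ij tC]]]]; exists i, j, C; split=> //.
  by move/eqC.
exact/eqC.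
Qed.

(** The walk is stopped at its first visit to [x]. *)
Lemma owalk_until K N n i a b x : owalk G K N n i a b x ->
  exists m c d, owalk G K (N :\ x) m i c d x.
Proof.
move=> ix; suff: forall y, owalk G K N n i a b y ->
    owalk G K (N :\ x) n i a b y \/ exists m c d, owalk G K (N :\ x) m i c d x.
  by case/(_ x ix) => // ix'; exists n, a, b.
move=> y; elim=> {n i a b y ix} [i e y iy|n i a b y e z _ [IH|IH] yz pass_y]; last by right.
  by left; apply: OwalkEdge.
have [yx|neq_yx] := eqVneq y x; first by right; rewrite yx in IH; exists n, a, b.
left; apply: OwalkSnoc IH yz _; move: pass_y.
by case: b => //; case: (src_mark _ _ _ _) => //=; rewrite in_setD1 neq_yx.
Qed.

(** Concatenate the two walks at [x].  If [x] is a non-collider of the result, or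
    a collider above [C], the walk is open given [C]; otherwise [x] is a collider
    and conditioning on it opens the walk, provided that [x] is not visited
    elsewhere. *)
Lemma connected_trans C i j x : connected G C i x -> connected G C x j ->
  connected G C i j \/ connected G (x |: C) i j.
Proof.
have [->|neq_ix] := eqVneq i x; first by left.
have [->|neq_jx] := eqVneq j x; first by left.
case=> iC xC [/eqP|[n [a [b ix]]]]; first by rewrite (negPf neq_ix).
case=> _ jC [/esym/eqP|[m [c [d xj]]]]; first by rewrite (negPf neq_jx).
have [n' [a' [b' ix']]] := owalk_until ix.
have [m' [d' [c' /owalk_rev xj']]] := owalk_until (owalk_rev xj).
have subN : ~: C :\ x \subset ~: C by apply: subsetDl.
have [pass_x|npass_x] := boolP (passes (anS G C) (~: C) x b' c').
  left; split=> //; right; exists (n' + m'), a', d'.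
  by apply: owalk_cat pass_x; [exact: owalk_sub ix' | exact: owalk_sub xj'].
have subK : anS G C \subset anS G (x |: C).
  by apply/subsetP => v /in_anS[u uC vu]; apply/in_anS; exists u; rewrite // in_setU1 uC orbT.
right; split; rewrite ?in_setU1 ?negb_or ?neq_ix ?neq_jx //; right; exists (n' + m'), a', d'.
have -> : ~: (x |: C) = ~: C :\ x.
  by apply/setP => v; rewrite !(in_setC, in_setU1, in_setD1) negb_or.
apply: owalk_cat (owalk_sub subK (subxx _) ix') (owalk_sub subK (subxx _) xj') _.
case: b' c' npass_x {ix' xj'} => [] [] //=; rewrite ?in_setC ?xC //= => _.
by apply: (subsetP (sub_anS _ _)); rewrite setU11.
Qed.

End Noncause.

(** * Shortest connecting walks have colliders only *)

Section AcyclicWalks.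
Variables (V : finType) (G : dmg V).
Hypothesis acG : acyclic G.
Implicit Types (x y z u v w t i j : V) (K N C : {set V}) (a b c d : mark).

Lemma acyclic_owalk_mark K N n x a b y : owalk G K N n x a b y ->
  a <> InnerTail /\ b <> InnerTail.
Proof.
have src u e v : dmg_step G u e v -> src_mark G u e v <> InnerTail.
  by move=> uv; rewrite (acyclic_src_mark acG uv); case: ifP.
have tgt u e v : dmg_step G u e v -> tgt_mark G u e v <> InnerTail.
  by rewrite -step_rev; apply: src.
elim=> {n x a b y} [x e y xy|n x a b y e z _ [aI _] yz _]; split; auto.
Qed.

(** From [k] along a directed path to its first node in [C], and back. *)
Lemma detour C (k c : V) : c \in C -> k \in an G c -> k \notin C ->
  exists n, owalk G C (~: C) n k OuterTail OuterTail k.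
Proof.
move=> cC; elim/an_ind_left => [|v w vw _ IH vC]; first by rewrite cC.
have vwM : src_mark G v To w = OuterTail by rewrite (acyclic_src_mark (e := To) acG).
have vwW : owalk G C (~: C) 1 v OuterTail Head w.
  by rewrite -vwM; exact: (@OwalkEdge _ _ _ _ v To w).
have [wC|wC] := boolP (w \in C).
  by exists 2; apply: owalk_cat vwW (owalk_rev vwW) _.
have [n wwW] := IH wC; exists (1 + n + 1).
have vW := owalk_cat vwW wwW; rewrite /= in_setC wC in vW.
by apply: owalk_cat (vW isT) (owalk_rev vwW) _; rewrite /= in_setC.
Qed.

(** Detours move all colliders into [C] itself.  The length of walks with this
    property is the measure for the minimality argument below. *)
Lemma owalk_detour C n x a b y : owalk G (anS G C) (~: C) n x a b y ->
  exists m, owalk G C (~: C) m x a b y.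
Proof.
elim=> {n x a b y} [x e y xy|n x a b y e z _ [m xy] yz pass_y].
  by exists 1; apply: OwalkEdge.
have yzW : owalk G C (~: C) 1 y (src_mark G y e z) (tgt_mark G y e z) z by exact: OwalkEdge.
have [pass|npass] := boolP (passes C (~: C) y b (src_mark G y e z)).
  by exists (m + 1); apply: owalk_cat pass.
have [bH srcH yC] : [/\ b = Head, src_mark G y e z = Head & y \notin C].
  by move: pass_y npass; case: (b); case: (src_mark _ _ _ _) => //= ->.
move: pass_y yzW xy; rewrite bH srcH => /in_anS[c cC yc] yzW xy.
have [k yyW] := detour cC yc yC; exists (m + k + 1).
have yW := owalk_cat xy yyW; rewrite /= in_setC yC in yW.
by apply: owalk_cat (yW isT) yzW _; rewrite /= in_setC.
Qed.

End AcyclicWalks.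

Lemma edge_link (V : finType) (G : dmg V) x e y : dmg_step G x e y -> inducing_link G x y.
Proof.
by move=> xy; exists 1, (src_mark G x e y), (tgt_mark G x e y); apply: OwalkEdge.
Qed.

(** The situation of a shortest counterexample: [nij] says that a walk of [G2] of
    length [n] is one, and [IH] is its minimality. *)
Section ColliderWalk.
Variables (V : finType) (G1 G2 : dmg V).
Hypotheses (ac2 : acyclic G2).
Hypothesis noncause12 : forall x t, x != t -> inducing_link G2 x t ->
  noncause G1 x t -> x \notin an G2 t.
Implicit Types (x y z u v w t i j : V) (C : {set V}) (a b c d : mark).
Variables (C : {set V}) (i j : V) (n : nat).
Hypotheses (iC : i \notin C) (jC : j \notin C).
Hypothesis nij : ~ connected G1 C i j.
Hypothesis IH : forall m x a b y, m < n -> x \notin C -> y \notin C ->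
  owalk G2 C (~: C) m x a b y -> connected G1 C x y.

Definition extends_to_end v b m : Prop :=
  (m = n /\ v = j) \/
  exists q c d, [/\ owalk G2 C (~: C) q v c d j, passes C (~: C) v b c & m + q = n].

(** What is known about a prefix, from its last edge [t -- v].  Either it has
    met colliders only, or it ends with an edge [t --> v] out of a non-collider
    [t], which is known to be a non-cause of [i], [j] and [C]. *)
Definition last_edge_state a b v : Prop :=
  exists t e, [/\ dmg_step G2 t e v, b = tgt_mark G2 t e v &
    (t \in i |: C /\ exists k, owalk G2 C set0 k i a b v) \/
    (e = To /\ forall s, s \in i |: (j |: C) -> noncause G1 t s)].

(** A non-collider [y] outside [C] splits the walk into two shorter ones, so it is
    connected to [i] and [j] in [G1] and hence a non-cause of [i], [j] and [C].
    The walk enters it by a head: either along an edge out of another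
    non-collider, or from [i] or a node of [C], of which [y] is no parent.  So
    the walk leaves it by a tail. *)
Lemma collider_walk_prefix m a b v : owalk G2 C (~: C) m i a b v ->
  extends_to_end v b m ->
  last_edge_state a b v.
Proof.
suff gen u : owalk G2 C (~: C) m u a b v -> u = i -> extends_to_end v b m ->
    last_edge_state a b v by move/gen; apply.
elim=> {m u a b v} [x e y xy xi _|m x a b y e z xy IHxy yz pass_y xi ext_z].
  exists x, e; split=> //; left; rewrite xi setU11; split=> //.
  by exists 1; apply: OwalkEdge; rewrite -xi.
have [q [d [yj qn]]] : exists q d, owalk G2 C (~: C) q y (src_mark G2 y e z) d j /\ m + q = n.
  have yzW : owalk G2 C (~: C) 1 y (src_mark G2 y e z) (tgt_mark G2 y e z) z by exact: OwalkEdge.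
  case: ext_z => [[mn zj]|[q [c [d [zj pass_z qn]]]]].
    by exists 1, (tgt_mark G2 y e z); rewrite addn1 -zj.
  by exists (1 + q), d; rewrite addnA addn1; split=> //; apply: owalk_cat yzW zj pass_z.
have [t [f [ty bE state]]] : last_edge_state a b y.
  by apply: IHxy xi _; right; exists q, (src_mark G2 y e z), d.
rewrite {}xi in xy.
have srcE := acyclic_src_mark ac2 yz.
have [_ bI] := acyclic_owalk_mark ac2 xy.
have tail_into s : (forall r, r \in i |: (j |: C) -> noncause G1 t r) -> f = To ->
    s \in i |: (j |: C) -> s = y -> False.
  move=> nct fT sC sy; rewrite fT in ty.
  have := noncause12 (dir_neq ty) (edge_link ty).
  by rewrite -sy => /(_ (nct _ sC)); rewrite sy dir_an.
exists y, e; split=> //.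
have [yC|yC] := boolP (y \in C).
  have yijC : y \in i |: (j |: C) by rewrite !in_setU1 yC !orbT.
  case: state => [[tC [k iy]]|[fT nct]]; last by case: (tail_into y).
  left; rewrite in_setU1 yC orbT; split=> //; exists k.+1; apply: OwalkSnoc iy yz _.
  move: pass_y bI; rewrite srcE => pass_y bI; move: pass_y.
  by case: (b) bI => // _; case: ifP => //= _; rewrite in_setC yC.
right.
have nc_y s : s \in i |: (j |: C) -> noncause G1 y s.
  have iy : connected G1 C i y.
    by apply: IH xy => //; rewrite -qn; have := owalk_gt0 yj; lia.
  have yj' : connected G1 C y j.
    by apply: IH yj => //; rewrite -qn; have := owalk_gt0 xy; lia.
  by move=> sC; exists i, j, C; split=> //; case: (connected_trans iy yj').
split=> //.
have bH : b = Head.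
  case: state => [[tC _]|[fT _]]; last by rewrite bE fT.
  case: f ty bE {tail_into} => // yt _.
  have tijC : t \in i |: (j |: C).
    by move: tC; rewrite !in_setU1 => /orP[]->; rewrite ?orbT.
  have := noncause12 (dir_neq yt) (edge_link (e := To) yt) (nc_y t tijC).
  by rewrite dir_an.
move: pass_y; rewrite bH srcE; case: ifP => [_|he _]; first by rewrite /= (negPf yC).
by case: e yz he {srcE ext_z yj}.
Qed.

(** From a first non-collider on, the prefix would end with directed edges out of
    non-causes of [j], up to an edge into [j] itself. *)
Lemma collider_walk a b : owalk G2 C (~: C) n i a b j ->
  exists m, owalk G2 C set0 m i a b j.
Proof.
move=> ij; have [|t [e [tj _]]] := collider_walk_prefix ij; first by left.
case=> [[_]|[eT nct]] //; exfalso; rewrite {e}eT in tj.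
have jijC : j \in i |: (j |: C) by rewrite !in_setU1 eqxx orbT.
have := noncause12 (dir_neq tj) (edge_link (e := To) tj) (nct _ jijC).
by rewrite dir_an.
Qed.

End ColliderWalk.

(** * Shortest chains of inducing links *)

(** For the nodes of a chain, membership in [C] distinguishes the inner nodes from
    the two ends, so one condition asks for heads at the inner nodes only. *)
Definition head_link (V : finType) (G : dmg V) (C : {set V}) (x y : V) : Prop :=
  exists n a b, [/\ owalk G (an G x :|: an G y) set0 n x a b y,
    x \in C -> a = Head & y \in C -> b = Head].

Section Chains.
Variables (V : finType) (G : dmg V).
Implicit Types (x y z u v w i j : V) (K N C : {set V}) (a b c d : mark).

Lemma head_link_inducing C x y : head_link G C x y -> inducing_link G x y.
Proof. by case=> n [a [b [xy _ _]]]; exists n, a, b. Qed.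

Lemma inducing_link_sym x y : inducing_link G x y -> inducing_link G y x.
Proof. by case=> n [a [b xy]]; exists n, b, a; rewrite setUC; apply: owalk_rev. Qed.

(** The tail leads to an ancestor of [x], which would close a directed cycle, or
    to an ancestor of [y]. *)
Lemma inducing_tail n x a b y : acyclic G ->
  owalk G (an G x :|: an G y) set0 n x a b y -> a <> Head -> x \in an G y.
Proof.
move=> acG xy /(owalk_tail_step (@anU_closed _ G x y) xy)[w xw wA].
have {wA} : w \in an G x :|: an G y by case: wA => // -[wy _]; rewrite in_setU wy orbT.
case/setUP=> [wx|wy]; last exact: an_trans (dir_an xw) wy.
by move: (dir_neq xw); rewrite (acyclic_antisym acG (dir_an xw) wx) eqxx.
Qed.

(** An ancestor [y] of [x] or [z] is an admissible collider on an inducing walk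
    from [x] to [z]. *)
Lemma head_link_merge C x y z : head_link G C x y -> head_link G C y z -> y \in C ->
  y \in an G x :|: an G z -> head_link G C x z.
Proof.
case=> n [a [b [xy xa yb]]] [m [c [d [yz yc zd]]]] yC yA.
exists (n + m), a, d; split=> //.
have subA := an_sub_anU yA.
have xyA : owalk G (an G x :|: an G z) set0 n x a b y.
  by apply: owalk_sub xy; rewrite // subUset subsetUl.
have yzA : owalk G (an G x :|: an G z) set0 m y c d z.
  by apply: owalk_sub yz; rewrite // subUset subA subsetUr.
by apply: owalk_cat xyA yzA _; rewrite yb // yc.
Qed.

Lemma head_links_owalk C K (f : nat -> V) n :
  (forall r, r <= n -> head_link G C (f r) (f r.+1)) ->
  (forall r, 0 < r <= n -> f r \in C) ->
  (forall r, r <= n.+1 -> an G (f r) \subset K) ->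
  exists m a b, [/\ owalk G K set0 m (f 0) a b (f n.+1),
    f 0 \in C -> a = Head & f n.+1 \in C -> b = Head].
Proof.
move=> links inC inK.
suff gen p : p <= n -> exists m a b, [/\ owalk G K set0 m (f 0) a b (f p.+1),
    f 0 \in C -> a = Head & f p.+1 \in C -> b = Head] by exact: gen (leqnn n).
elim: p => [|p IH] le_pn; have [m [a [b [step srcH tgtH]]]] := links _ le_pn.
  exists m, a, b; split=> //; apply: owalk_sub step; rewrite // subUset !inK //.
have [k [c [d [prefix cH dH]]]] := IH (ltnW le_pn).
have pC : f p.+1 \in C by rewrite inC.
exists (k + m), c, b; split=> //.
have stepK : owalk G K set0 m (f p.+1) a b (f p.+2).
  by apply: owalk_sub step; rewrite // subUset !inK // ltnW.
apply: owalk_cat prefix stepK _; rewrite dH // srcH //=.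
by apply: (subsetP (inK p.+1 _)); rewrite ?an_refl // ltnW.
Qed.

Definition chain C i j n (f : nat -> V) : Prop :=
  [/\ f 0 = i, f n.+1 = j, forall r, r <= n -> head_link G C (f r) (f r.+1) &
      forall r, 0 < r <= n -> f r \in C].

Lemma chain_of_collider_walk C n i a b j : acyclic G -> i \notin C -> j \notin C ->
  owalk G C set0 n i a b j -> exists m f, chain C i j m f.
Proof.
move=> acG iC jC ij.
suff gen x y : owalk G C set0 n x a b y -> x = i -> (y \in C -> b = Head) ->
    exists m f, chain C i y m f.
  by apply: (gen i j) => //; rewrite (negPf jC).
elim=> {n x a b y ij} [x e y xy xi yH|n x a b y e z xy IH yz pass_y xi zH].
  exists 0, (fun r => if r is 0 then i else y); split=> // -[|r] //= _.
  exists 1, (src_mark G x e y), (tgt_mark G x e y); split=> //; last by rewrite (negPf iC).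
  by rewrite -xi; apply: OwalkEdge.
have [_ bI] := acyclic_owalk_mark acG xy.
have [yC bH srcH] : [/\ y \in C, b = Head & src_mark G y e z = Head].
  move: pass_y bI; rewrite (acyclic_src_mark acG yz).
  by case: (b) => //; case: ifP => //=; rewrite inE.
have [m [f [f0 fm links inC]]] := IH xi (fun _ => bH).
exists m.+1, (fun r => if r <= m.+1 then f r else z); split=> [//||r|r].
- by rewrite ltnn.
- case: (ltngtP r m.+1) => // [lt_rm _|-> _]; first exact: links.
  rewrite fm; exists 1, (src_mark G y e z), (tgt_mark G y e z).
  by split=> //; apply: OwalkEdge.
- case/andP=> r0; case: (ltngtP r m.+1) => // [lt_rm _|-> _]; last by rewrite fm.
  by apply: inC; rewrite r0.
Qed.

Lemma chain_shortcut C i j n f p q : chain C i j n f -> p.+1 < q <= n.+1 ->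
  head_link G C (f p) (f q) ->
  exists2 m, m < n & exists g, chain C i j m g.
Proof.
case=> f0 fn links inC /andP[lt_pq le_qn] pq; pose k := q - p.+1.
exists (n - k); first by rewrite /k; lia.
exists (fun r => if r <= p then f r else f (r + k)); split=> //=.
- have -> : (n - k).+1 <= p = false by rewrite /k; lia.
  by rewrite -fn; congr f; rewrite /k; lia.
- move=> r le_r; have [lt_rp|lt_pr|->] := ltngtP r p.
  + by apply: links; rewrite /k in le_r; lia.
  + by rewrite addSn; apply: links; rewrite /k in le_r *; lia.
  + by have -> : p.+1 + k = q by rewrite /k; lia.
move=> r /andP[r0 le_r]; case: leqP => lt_r; apply: inC; rewrite /k in le_r *; lia.
Qed.

End Chains.

Section MinimalChain.
Variables (V : finType) (G : dmg V).
Implicit Types (x y z u v w : V) (K N : {set V}).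
Variables (C : {set V}) (i j : V) (n : nat) (f : nat -> V).
Hypothesis chain_f : chain G C i j n f.

Lemma chain_span p q K : p < q <= n.+1 ->
  (forall r, p <= r <= q -> an G (f r) \subset K) ->
  exists m a b, owalk G K set0 m (f p) a b (f q).
Proof.
case: chain_f => _ _ links inC pq inK.
have [| | |m [a [b]]] := @head_links_owalk _ G C K (fun r => f (p + r)) (q - p.+1).
- by move=> r le_r; rewrite addnS; apply: links; lia.
- by move=> r le_r; apply: inC; lia.
- by move=> r le_r; apply: inK; lia.
rewrite addn0 (_ : p + (q - p.+1).+1 = q); last by lia.
by case=> pqW _ _; exists m, a, b.
Qed.

Hypothesis shortest : forall p q, p.+1 < q <= n.+1 -> ~ head_link G C (f p) (f q).

(** Otherwise the two links at [f k] could be merged. *)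
Lemma chain_neighbours k : 0 < k <= n -> f k \notin an G (f k.-1) :|: an G (f k.+1).
Proof.
case: k => // k /andP[_ kn] /=; case: chain_f => _ _ links inC; apply/negP => kA.
apply: (@shortest k k.+2); first lia.
by apply: (head_link_merge (links _ _) (links _ _)) kA; [lia | lia | apply: inC; lia].
Qed.

Hypotheses (jC : j \notin C) (neq_ij : i != j).

Lemma chain_neq p q : p.+1 < q <= n.+1 -> f p != f q.
Proof.
case: chain_f => f0 fn links inC pq; apply/eqP => fpq.
(* If f p = f q, the link after f q could be attached to f p. *)
have [lt_qn|] := ltnP q n.+1.
  by apply: (@shortest p q.+1); [lia | rewrite fpq; apply: links].
move=> le_nq; have qE : q = n.+1 by lia.
move: fpq; rewrite qE fn; case: p pq => [|p] pq; first by rewrite f0; apply/eqP.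
by move=> pj; move: jC; rewrite -pj inC //; lia.
Qed.

Hypothesis iC : i \notin C.

Lemma chain_endpoint r : r <= n.+1 -> f r \in C -> 0 < r <= n.
Proof.
case: chain_f => f0 fn _ _ le_r rC.
rewrite lt0n -ltnS ltn_neqAle le_r andbT; apply/andP; split.
  by apply: contraTneq rC => ->; rewrite f0.
by apply: contraTneq rC => ->; rewrite fn.
Qed.

Hypothesis acG : acyclic G.

Definition spans k p q : Prop :=
  p < k < q /\ q <= n.+1 /\
  (forall r, p < r < q -> r != k -> f r \in an G (f p) :|: an G (f q)).

(** Enlarge the stretch from [p] to [q] as long as its ends are adjacent.  An
    inducing walk between the ends is not a head link, as the chain is shortest,
    so it has a tail at an inner node of the chain, say [f p]; then [f p] is an
    ancestor of [f q] and the stretch may start at [p.-1] instead.  This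
    never goes beyond [i] or [j], where head links admit tails.
    Once the ends are not adjacent, [f k] is not an ancestor of them either,
    because the links of the stretch would form an inducing walk. *)
Lemma separating_span k : 0 < k <= n -> exists p q,
  [/\ spans k p q, f p != f q, ~ inducing_link G (f p) (f q) &
      f k \notin an G (f p) :|: an G (f q)].
Proof.
move=> kn; have: spans k k.-1 k.+1.
  by split; [lia | split; [lia | move=> r rk /eqP rk'; lia]].
move: k.-1 k.+1 => p q pq.
have [l le_l] : exists l, n.+1 - (q - p) < l by exists (n.+1 - (q - p)).+1.
elim: l p q pq le_l => // l IH p q [pkq [qn inA]] le_l.
have neq_pq : f p != f q by apply: chain_neq; lia.
have [[m [a [b pqW]]]|npq] := pselect (inducing_link G (f p) (f q)); last first.
  exists p, q; split=> //; apply/negP => kA; apply: npq.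
  apply: chain_span => [|r rpq]; first lia.
  have [->|rp] := eqVneq r p; first exact: subsetUl.
  have [->|rq] := eqVneq r q; first exact: subsetUr.
  apply: an_sub_anU; have [->//|rk] := eqVneq r k; apply: inA rk.
  by move/eqP: rp; move/eqP: rq; lia.
have [[pC aT]|[qC bT]] : (f p \in C /\ a <> Head) \/ (f q \in C /\ b <> Head).
- apply: contrapT => nor; apply: (@shortest p q); first lia.
  exists m, a, b; split=> // [pC|qC]; apply: contrapT => T; apply: nor; [left|right]; split=> //.
- have pq := inducing_tail acG pqW aT.
  have /andP[p0 _] : 0 < p <= n by apply: chain_endpoint pC; lia.
  apply: (IH p.-1 q); last by lia.
  split; [lia | split=> // r rpq rk].
  have subA : an G (f p) :|: an G (f q) \subset an G (f p.-1) :|: an G (f q).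
    by rewrite subUset subsetUr andbT an_sub_anU // in_setU pq orbT.
  have [->|rp] := eqVneq r p; first by rewrite in_setU pq orbT.
  by apply: (subsetP subA); apply: inA rk; move/eqP: rp; lia.
have qp : f q \in an G (f p).
  by apply: inducing_tail bT => //; rewrite setUC; exact: owalk_rev pqW.
have /andP[_ qn'] : 0 < q <= n by apply: chain_endpoint qC; lia.
apply: (IH p q.+1); last by lia.
split; [lia | split=> // r rpq rk].
have subA : an G (f p) :|: an G (f q) \subset an G (f p) :|: an G (f q.+1).
  by rewrite subUset subsetUl; apply: an_sub_anU; rewrite in_setU qp.
have [->|rq] := eqVneq r q; first by rewrite in_setU qp.
by apply: (subsetP subA); apply: inA rk; move/eqP: rq; lia.
Qed.

(** The proper ancestors of the ends of the stretch separate the ends, and adding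
    [f k] connects them through the chain; the neighbours of [f k] are among
    these ancestors and the ends. *)
Lemma chain_noncause k r : 0 < k <= n -> r = k.-1 \/ r = k.+1 -> noncause G (f k) (f r).
Proof.
move=> kn rk; have [p [q [[pkq [qn inA]] neq_pq npq kA]]] := separating_span kn.
set A := an G (f p) :|: an G (f q) in inA kA.
set S := A :\ f p :\ f q.
have memS t : t \in A -> t \in f p |: (f q |: S).
  by rewrite /S !(in_setU1, in_setD1) => ->; case: (t == f p); case: (t == f q).
have pA : f p \in A by rewrite in_setU an_refl.
have qA : f q \in A by rewrite in_setU an_refl orbT.
have neq_pk : f p != f k by apply: contraNneq kA => <-.
have neq_qk : f q != f k by apply: contraNneq kA => <-.
exists (f p), (f q), S; split.
- by move=> pqS; apply: npq; apply/(inducing_pathP G neq_pq 0 2).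
- have [| |m [a [b pqW]]] := @chain_span p q (A :|: an G (f k)); first lia.
    move=> t tpq; have [->|tk] := eqVneq t k; first exact: subsetUr.
    apply: subset_trans (subsetUl _ _).
    have [->|tp] := eqVneq t p; first exact: subsetUl.
    have [->|tq] := eqVneq t q; first exact: subsetUr.
    by apply: an_sub_anU; apply: inA tk; move/eqP: tp; move/eqP: tq; lia.
  apply: connected_of_owalk pqW; rewrite ?sub0set //.
  + rewrite setUC setSU //; apply/subsetP => t tk; apply/in_anS.
    by exists (f k); rewrite ?setU11.
  + by rewrite /S in_setU1 !in_setD1 eqxx (negPf neq_pk) andbF.
  + by rewrite /S in_setU1 !in_setD1 eqxx (negPf neq_qk).
apply: memS; have [->//|rp] := eqVneq r p; have [->//|rq] := eqVneq r q.
apply: inA; last by apply/eqP; lia.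
by move/eqP: rp; move/eqP: rq; lia.
Qed.

End MinimalChain.

(** * Transfer of connections between acyclic graphs *)

(** The three hypotheses on the pair are what a common DPAG that is sound for both
    graphs and arrowhead complete provides. *)
Section Transfer.
Variables (V : finType) (G1 G2 : dmg V).
Hypotheses (ac1 : acyclic G1) (ac2 : acyclic G2).
Hypothesis link21 : forall x y, x != y -> inducing_link G2 x y -> inducing_link G1 x y.
Hypothesis noncause12 : forall x t, x != t -> inducing_link G2 x t ->
  noncause G1 x t -> x \notin an G2 t.
Hypothesis noncause21 : forall x t, x != t -> inducing_link G1 x t ->
  noncause G2 x t -> x \notin an G1 t.

(** The inner nodes of a shortest chain are non-causes of their neighbours in
    [G2], so in [G1] the links of the chain have heads at them as well and form a
    walk whose colliders are ancestors of [C], [i] or [j]. *)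
Lemma chain_transfer (C : {set V}) i j n f : i \notin C -> j \notin C -> i != j ->
  chain G2 C i j n f -> connected G1 C i j.
Proof.
move=> iC jC neq_ij; elim/ltn_ind: n f => n IH f chain_f; apply: contrapT => nij.
have shortest p q : p.+1 < q <= n.+1 -> ~ head_link G2 C (f p) (f q).
  by move=> pq /(chain_shortcut chain_f pq)[m lt_mn [g chain_g]]; apply/nij/(IH m lt_mn g).
have [f0 fn links inC] := chain_f.
have nbr := chain_neighbours chain_f shortest.
have neq_nbr r : r <= n -> f r != f r.+1.
  move=> rn; case: r rn => [|r] rn.
    case: (n) fn nbr => [fn _|m _ nbr1]; first by rewrite f0 fn.
    by apply: contraNneq (nbr1 1 isT) => /= ->; rewrite in_setU an_refl.
  by apply: contraNneq (nbr r.+1 rn) => /= <-; rewrite in_setU an_refl orbT.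
have link1 r : r <= n -> inducing_link G1 (f r) (f r.+1).
  by move=> rn; apply: link21 (neq_nbr r rn) (head_link_inducing (links r rn)).
have arrow_next r : 0 < r <= n -> f r \notin an G1 (f r.+1).
  case/andP=> r0 rn; apply: noncause21 (neq_nbr r rn) (link1 r rn) _.
  by apply: (chain_noncause chain_f shortest jC neq_ij iC ac2); rewrite ?r0 //; right.
have arrow_prev r : r < n -> f r.+1 \notin an G1 (f r).
  move=> rn; apply: noncause21.
  - by rewrite eq_sym neq_nbr // ltnW.
  - by apply: inducing_link_sym; apply: link1; exact: ltnW.
  by apply: (chain_noncause chain_f shortest jC neq_ij iC ac2); [|left].
have links1 r : r <= n -> head_link G1 C (f r) (f r.+1).
  move=> rn; have [m [a [b rW]]] := link1 r rn; exists m, a, b.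
  split=> // rC; apply: contrapT => tail.
    have /arrow_next/negP[] : 0 < r <= n.
      by apply: (chain_endpoint chain_f jC iC _ rC); lia.
    exact: inducing_tail rW tail.
  have /andP[_ /arrow_prev/negP[]] : 0 < r.+1 <= n.
    by apply: (chain_endpoint chain_f jC iC _ rC); lia.
  by apply: inducing_tail tail => //; rewrite setUC; exact: owalk_rev rW.
pose K := anS G1 C :|: (an G1 i :|: an G1 j).
have [|m [a [b [ijW _ _]]]] := @head_links_owalk _ G1 C K f n links1 inC.
  move=> r rn; have [->|r0] := eqVneq r 0; first by rewrite f0 /K setUCA subsetUl.
  have [->|rn'] := eqVneq r n.+1; first by rewrite fn /K setUA subsetUr.
  apply: subset_trans (subsetUl _ _); apply/subsetP => v vr; apply/in_anS; exists (f r) => //.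
  by apply: inC; move/eqP: r0; move/eqP: rn'; lia.
apply: nij; rewrite f0 fn in ijW; apply: connected_of_owalk ijW => //; exact: sub0set.
Qed.

Lemma connected_transfer (C : {set V}) i j : connected G2 C i j -> connected G1 C i j.
Proof.
case=> iC jC [->|[n0 [a0 [b0 /(owalk_detour ac2)[n ij]]]]]; first by split=> //; left.
elim/ltn_ind: n i j iC jC a0 b0 ij => n IH i j iC jC a b ij; apply: contrapT => nij.
have [m ijC] := collider_walk ac2 noncause12 iC jC nij
  (fun m x a b y lt_m xC yC xy => IH m lt_m x y xC yC a b xy) ij.
have neq_ij : i != j by apply: contra_notN nij => /eqP->; split=> //; left.
have [k [f chain_f]] := chain_of_collider_walk ac2 iC jC ijC.
exact/nij/(chain_transfer iC jC neq_ij chain_f).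
Qed.
End Transfer.

(** * Completeness under acyclicity suffices *)

Lemma contains_link (V : finType) (P : dpag V) (G : dmg V) x y : contains P G -> x != y ->
  adjacent P x y <-> inducing_link G x y.
Proof.
case=> adjP _ _ neq_xy; rewrite (adjP x y neq_xy).
exact: iff_sym (inducing_pathP G neq_xy 0 3).
Qed.

Lemma markov_equiv_link (V : finType) (G1 G2 : dmg V) x y : x != y -> markov_equiv G1 G2 ->
  inducing_link G1 x y <-> inducing_link G2 x y.
Proof.
move=> neq_xy /markov_equivP eqC.
by split=> /(inducing_pathP _ neq_xy 0 1) conn; apply/(inducing_pathP _ neq_xy 0 1) => C xC yC;
  apply/eqC; apply: conn.
Qed.

(** A non-cause of [G1] is one of all its Markov equivalents, so completeness
    puts an arrowhead at [x] in the DPAG, and any graph in the DPAG obeys it. *)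
Lemma noncause_contains Psi Phi (V : finType) (G1 G2 : dmg V) x t :
  arrowhead_complete Psi Phi -> Psi V G1 -> contains (Phi V (IM G1)) G2 ->
  x != t -> inducing_link G2 x t -> noncause G1 x t -> x \notin an G2 t.
Proof.
move=> arrowPhi Psi1 P_G2 neq_xt xt nc; case: (P_G2) => _ arrowP _; apply: arrowP.
apply: arrowPhi => //; first exact/(contains_link P_G2 neq_xt).
by move=> G' _ eqG; apply/noncause_an/(noncause_equiv eqG).
Qed.

Theorem theorem2 (Psi : background) (Phi : dpag_map)
    (hPsi : acyclification_compatible Psi) :
  (sound (under_acyclicity Psi) Phi -> sound Psi Phi) /\
  ((arrowhead_complete (under_acyclicity Psi) Phi ->
      arrowhead_complete Psi Phi) /\
   (tail_complete (under_acyclicity Psi) Phi -> tail_complete Psi Phi)) /\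
  (sound (under_acyclicity Psi) Phi ->
   arrowhead_complete (under_acyclicity Psi) Phi ->
   markov_complete Psi Phi).
Proof.
have acyW V (G G' : dmg V) : acyclification G G' -> Psi V G' ->
    under_acyclicity Psi G' /\ IM G' = IM G.
  move=> acyG PsiG'; split; last exact: acyclification_markov_equiv.
  by rewrite /under_acyclicity PsiG'; case: acyG.
split; [|split; [split|]].
- move=> soundPhi V G PsiG; have [[G0 acy0 Psi0] causeG noncauseG] := hPsi _ _ PsiG.
  have [ac0 IM0] := acyW _ _ _ acy0 Psi0.
  have P_G0 := soundPhi _ _ ac0; rewrite IM0 in P_G0; split.
  + move=> i j neq_ij; rewrite (contains_link P_G0 neq_ij).
    rewrite (markov_equiv_link neq_ij IM0).
    exact: (inducing_pathP G neq_ij 0 3).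
  + move=> i j; apply: contraTN => /causeG[G1 [acy1 Psi1 ji]].
    have [ac1 IM1] := acyW _ _ _ acy1 Psi1.
    have [_ arrow1 _] := soundPhi _ _ ac1; rewrite IM1 in arrow1.
    by apply: contraL ji; apply: arrow1.
  move=> i j ij; apply: contraT => /noncauseG/(_ G0 acy0 Psi0).
  by case: P_G0 => _ _ /(_ i j ij) ->.
- move=> arrowPhi V G PsiG i j neq_ij; have [[G0 acy0 Psi0] _ _] := hPsi _ _ PsiG.
  have [ac0 IM0] := acyW _ _ _ acy0 Psi0; rewrite -IM0 => adj_ij nonanc.
  apply: arrowPhi => // G' /andP[PsiG' _] eqG'; apply: nonanc => //.
  exact: etrans eqG' IM0.
- move=> tailPhi V G PsiG i j neq_ij; have [[G0 acy0 Psi0] _ _] := hPsi _ _ PsiG.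
  have [ac0 IM0] := acyW _ _ _ acy0 Psi0; rewrite -IM0 => adj_ij anc.
  apply: tailPhi => // G' /andP[PsiG' _] eqG'; apply: anc => //.
  exact: etrans eqG' IM0.
move=> soundPhi arrowPhi V G1 G2 Psi1 Psi2; split=> [eqG|]; first by congr (Phi V _).
have [[H1 acy1 PsiH1] _ _] := hPsi _ _ Psi1; have [[H2 acy2 PsiH2] _ _] := hPsi _ _ Psi2.
have [ac1 IM1] := acyW _ _ _ acy1 PsiH1; have [ac2 IM2] := acyW _ _ _ acy2 PsiH2.
rewrite -IM1 -IM2 /markov_equiv -{}IM1 -{}IM2 => eqP.
have P1 := soundPhi _ _ ac1; have P2 := soundPhi _ _ ac2.
have P12 : contains (Phi V (IM H1)) H2 by rewrite eqP.
have P21 : contains (Phi V (IM H2)) H1 by rewrite -eqP.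
have link x y : x != y -> inducing_link H1 x y <-> inducing_link H2 x y.
  by move=> neq_xy; rewrite -(contains_link P1 neq_xy) -(contains_link P12 neq_xy).
have nc12 x t := @noncause_contains _ _ _ _ _ x t arrowPhi ac1 P12.
have nc21 x t := @noncause_contains _ _ _ _ _ x t arrowPhi ac2 P21.
have /andP[_ acyclic1] := ac1; have /andP[_ acyclic2] := ac2.
apply/markov_equivP => C i j; split.
  by apply: connected_transfer => // x y neq_xy /(link x y neq_xy).
by apply: connected_transfer => // x y neq_xy /(link x y neq_xy).
Qed.
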